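(* Let $\mathcal{H}=\mathbb{R}^d$ with Lebesgue measure $\pi$, where each $h\in\mathbb{R}^d$ is also regarded as a measurable function $h:\mathcal{X}\to[0,1]$ (jointly measurable in $(h,x)$). Let $A:\mathcal{X}^n\to\mathbb{R}^d$ be measurable with hypothesis sensitivity coefficient $c_A$, let $\sigma>0$ with $12nc_A^2\le\sigma^2$, let $Q_{\mathbf{x}}=\mathcal{N}(A(\mathbf{x}),\sigma^2I)$ (Hamiltonian $-\|h-A(\mathbf{x})\|^2/(2\sigma^2)$), let $n>8$ and $\delta>0$. Then with probability at least $1-\delta$ in $\mathbf{X}\sim\mu^n$, for all probability measures $P$ on $\mathcal{H}$, $$\mathbb{E}_{h\sim P}\left[kl(\hat L(h,\mathbf{X}),L(h))\right]\le\frac{2KL(P,Q_{\mathbf{X}})+\frac{6}{\sigma^2}\mathcal{V}(A)+\ln(2\sqrt n)+2\ln(1/\delta)}{n}.$$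
   Context: $\mathcal{X}$ is a measurable space with probability measure $\mu$, $\mathbf{X}=(X_1,\dots,X_n)\sim\mu^n$, $\mathbf{X}'$ an independent copy, $X\sim\mu$. $\|\cdot\|$ is the Euclidean norm. $c_A=\max_{k\in[n]}\sup_{\mathbf{x}\in\mathcal{X}^n,\,y,y'\in\mathcal{X}}\|A(S^k_y\mathbf{x})-A(S^k_{y'}\mathbf{x})\|$, where $S^k_y\mathbf{x}$ replaces the $k$-th coordinate of $\mathbf{x}$ by $y$. $\mathcal{V}(A)=\mathbb{E}\left[\|A(\mathbf{X})-\mathbb{E}[A(\mathbf{X}')]\|^2\right]$. $L(h)=\mathbb{E}[h(X)]$, $\hat L(h,\mathbf{x})=\frac1n\sum_{i=1}^n h(x_i)$. $kl(s,t)=s\ln\frac{s}{t}+(1-s)\ln\frac{1-s}{1-t}$ for $s,t\in[0,1]$. $KL(P,R)=\int\ln\frac{dP}{dR}\,dP$ if $P\ll R$ and $+\infty$ otherwise. *)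

(* Defs.v *)
From HB Require Import structures.
From mathcomp Require Import all_boot all_order all_algebra.
From mathcomp Require Import all_classical all_reals all_analysis.
Set Implicit Arguments. Unset Strict Implicit. Unset Printing Implicit Defensive.
Import Order.TTheory GRing.Theory Num.Theory.
Local Open Scope classical_set_scope.
Local Open Scope ring_scope.

(* Euclidean norm on R^d, represented as d.-tuple R (product sigma-algebra) *)
Definition enorm {R : realType} {d : nat} (v : d.-tuple R) : R :=
  Num.sqrt (\sum_(i < d) tnth v i ^+ 2).

Definition tsub {R : realType} {d : nat} (u v : d.-tuple R) : d.-tuple R :=
  [tuple tnth u i - tnth v i | i < d].

Definition replace_at {T : Type} {n : nat} (k : 'I_n) (y : T) (x : n.-tuple T)
  : n.-tuple T := [tuple if i == k then y else tnth x i | i < n].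

(* hypothesis sensitivity coefficient c_A (extended real; -oo if n = 0) *)
Definition sens_coef {R : realType} {T : Type} {n d : nat}
  (A : n.-tuple T -> d.-tuple R) : \bar R :=
  \big[Order.max/-oo%E]_(k < n)
    ereal_sup [set r : \bar R | exists (x : n.-tuple T) (y y' : T),
      r = (enorm (tsub (A (replace_at k y x)) (A (replace_at k y' x))))%:E].

Definition mean_vec {dX} {T : measurableType dX} {R : realType} {n d : nat}
  (m : set (n.-tuple T) -> \bar R) (A : n.-tuple T -> d.-tuple R) : d.-tuple R :=
  [tuple fine (\int[m]_x (tnth (A x) i)%:E) | i < d].

Definition var_A {dX} {T : measurableType dX} {R : realType} {n d : nat}
  (m : set (n.-tuple T) -> \bar R) (A : n.-tuple T -> d.-tuple R) : \bar R :=
  (\int[m]_x ((enorm (tsub (A x) (mean_vec m A))) ^+ 2)%:E)%E.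

Definition xlogxy {R : realType} (s t : R) : \bar R :=
  if s == 0 then 0%E else if t == 0 then +oo%E else (s * ln (s / t))%:E.

Definition klb {R : realType} (s t : R) : \bar R :=
  (xlogxy s t + xlogxy (1 - s) (1 - t))%E.

Definition KLdiv {dT} {T : measurableType dT} {R : realType}
  (P Q : probability T R) : \bar R :=
  if pselect (charge_of_finite_measure P `<< Q)
  then (\int[P]_x (ln (fine ((Radon_Nikodym (charge_of_finite_measure P) Q) x)))%:E)%E
  else +oo%E.

Definition emp_risk {R : realType} {T : Type} {H : Type} {n : nat}
  (loss : H -> T -> R) (h : H) (x : n.-tuple T) : R :=
  n%:R^-1 * \sum_(i < n) loss h (tnth x i).

Definition true_risk {dX} {T : measurableType dX} {R : realType} {H : Type}
  (mu : set T -> \bar R) (loss : H -> T -> R) (h : H) : R :=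
  fine (\int[mu]_z (loss h z)%:E)%E.

(* Main.v *)
Require Import Defs.
From HB Require Import structures.
From mathcomp Require Import all_boot all_order all_algebra.
From mathcomp Require Import all_classical all_reals all_analysis.
From mathcomp Require Import measurable_realfun.
From mathcomp Require Import ring lra zify.
Import Order.TTheory GRing.Theory Num.Theory.
Local Open Scope classical_set_scope.
Local Open Scope ring_scope.

(** By Donsker-Varadhan and Markov it suffices to bound the mean over the sample
    of [M x], the [Q x]-mean of [exp (n kl / 2)], by the square root of
    [2 sqrt n * exp (6 V / sigma^2)]. Let [q c] be the Gaussian weight centred at
    [c] and [a] the mean of [A]. Then [q (A x) ^ 2] equals
    [q a * q (2 A x - a) * exp (|A x - a|^2 / sigma^2)], so a weighted AM-GM
    inequality separates the two factors: Tonelli leaves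
    [E exp (n kl) <= 2 sqrt n] (Maurer's bound, through convexity in each
    coordinate and Abel's binomial identity) and the exponential moment of
    [|A - a|^2].

    For the latter, [Z = |A - a|^2] satisfies
    [|Z - Z'| <= c_A (sqrt Z + sqrt Z')] when one coordinate changes. Interpolating
    between the sample and an independent copy and exchanging one coordinate at a
    time gives [Cov (Z, e^(l Z)) <= 6 n c_A^2 l E (Z e^(l Z))], hence
    [E (Z e^(l Z)) <= 2 E Z E e^(l Z)] for [l <= 1 / sigma^2], which integrates to
    [E e^(l Z) <= e^(6 l E Z)]. *)

(** * Abel's identity and the maximum likelihood sum *)

(** The obstacle behind the whole proof is that the reference measure [Q x] moves with the sample,
    so the integral over the sample cannot be taken first, at fixed [h], where Maurer's bound lives.
    Squaring the weight buys one factor with a fixed centre. Its price is the exponent [n / 2] in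
    place of [n]: doubling back at the end puts a factor 2 on KL and on [ln (1 / delta)], while the
    square root of the moment bound keeps [ln (2 sqrt n)] and the variance term undoubled. The
    centre [2 A x - a] still depends on the sample, but translation invariance of Lebesgue measure
    makes the integral of its weight constant, and this common normalization cancels. The value
    [l = 1 / sigma^2] is dictated by the exponential factor in the squared weight, and
    [12 n c_A^2 <= sigma^2] keeps the covariance coefficient [6 n c_A^2 l] at most 1/2 up to
    there. *)

Section abel.
Variable R : realFieldType.

(** One factor of the power is split as [x + k]. The part with [k] is absorbed by
    [k * C(n+1, k) = (n+1) * C(n, k-1)], and reindexing shifts [x] by one. *)
Lemma alt_sum_bin_pow_rec (n m : nat) (x : R) :
  \sum_(k < n.+2) (-1) ^+ (n.+1 - k) * 'C(n.+1, k)%:R * (x + k%:R) ^+ m.+1 =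
  x * (\sum_(k < n.+2) (-1) ^+ (n.+1 - k) * 'C(n.+1, k)%:R * (x + k%:R) ^+ m) +
  n.+1%:R * (\sum_(k < n.+1) (-1) ^+ (n - k) * 'C(n, k)%:R * (x + 1 + k%:R) ^+ m).
Proof.
have -> : n.+1%:R * (\sum_(k < n.+1) (-1) ^+ (n - k) * 'C(n, k)%:R *
    (x + 1 + k%:R) ^+ m) = \sum_(k < n.+2)
    (-1) ^+ (n.+1 - k) * 'C(n.+1, k)%:R * (x + k%:R) ^+ m * k%:R :> R.
  rewrite [RHS]big_ord_recl/= mulr0 add0r mulr_sumr; apply: eq_bigr => k _.
  rewrite /= /bump/= add1n subSS -addrA nat1r.
  have := mul_bin_diag n.+1 k; move/(congr1 (fun i => i%:R : R)); rewrite !natrM/=.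
  move: (n.+1%:R : R) ('C(n, k)%:R : R) (k.+1%:R : R) ('C(n.+1, k.+1)%:R : R) => a b c e E.
  rewrite (_ : a * _ = (-1) ^+ (n - k) * (a * b) * (x + c) ^+ m); last by ring.
  by rewrite E; ring.
rewrite mulr_sumr -big_split/=; apply: eq_bigr => k _; rewrite exprS; ring.
Qed.

(** The sum is the [n]-th forward difference of the [m]-th power at [x], which annihilates degrees
    below [n]. It serves to evaluate one side of Abel's identity at 0. *)
Lemma alt_sum_bin_pow (n m : nat) (x : R) : (m <= n)%N ->
  \sum_(k < n.+1) (-1) ^+ (n - k) * 'C(n, k)%:R * (x + k%:R) ^+ m =
  if m == n then n`!%:R else 0.
Proof.
elim: m n x => [|m IH] [|n] x //.
- by rewrite big_ord1 subnn/= bin0 fact0 !mulr1.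
- move=> _; under eq_bigr do rewrite mulr1.
  have := exprDn (-1 : R) 1 n.+1; rewrite addNr expr0n/= mulr0n => E.
  by rewrite [RHS]E; apply: eq_bigr => i _; rewrite expr1n mulr1 mulr_natr.
- rewrite ltnS => mn; rewrite alt_sum_bin_pow_rec IH; last exact: leqW.
  rewrite IH// eqSS; have -> : (m == n.+1) = false by apply/eqP; lia.
  rewrite mulr0 add0r; case: ifP => _; last by rewrite mulr0.
  by rewrite factS natrM.
Qed.

(** The two sides of Cauchy's form of Abel's identity, as polynomials in the free variable. Both are
    Appell sequences, the derivative of each being [n] times its predecessor, so by induction they
    coincide as soon as they agree at 0. *)
Let q n : {poly R} :=
  \sum_(k < n.+1) ('C(n, k)%:R * k%:R ^+ k) *: ('X - k%:R%:P) ^+ (n - k).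
Let r n : {poly R} := \sum_(k < n.+1) (n ^_ k)%:R *: 'X^(n - k).

Lemma deriv_abel_lhs n : (q n.+1)^`() = n.+1%:R *: q n.
Proof.
rewrite /q raddf_sum big_ord_recr/= subnn expr0 linearZ/= derivC scaler0 addr0.
rewrite scaler_sumr; apply: eq_bigr => k _.
rewrite linearZ/= deriv_exp derivXsubC mul1r -scaler_nat !scalerA.
have kn : (k <= n)%N by rewrite -ltnS.
rewrite subSn//=; congr (_ *: _).
have := mul_bin_down n.+1 k; move/(congr1 (fun i => i%:R : R)).
rewrite subSn// !natrM.
move: (n.+1%:R : R) ('C(n, k)%:R : R) ((n - k).+1%:R : R) ('C(n.+1, k)%:R : R) => a b c e E.
by rewrite mulrA E; move: (k%:R ^+ k) => y; ring.
Qed.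

Lemma deriv_abel_rhs n : (r n.+1)^`() = n.+1%:R *: r n.
Proof.
rewrite /r raddf_sum big_ord_recr/= subnn expr0 linearZ/= derivC scaler0 addr0.
rewrite scaler_sumr; apply: eq_bigr => k _.
have kn : (k <= n)%N by rewrite -ltnS.
rewrite linearZ/= derivXn scalerA -scaler_nat scalerA subSn//=; congr (_ *: _).
rewrite -!natrM; congr (_%:R).
rewrite -ffactnS -subSn// ffactnSr; lia.
Qed.

Lemma horner0_abel_lhs n : (q n).[0] = n`!%:R.
Proof.
have := @alt_sum_bin_pow n n 0 (leqnn n); rewrite eqxx => <-.
rewrite /q horner_sum; apply: eq_bigr => k _.
have kn : (k <= n)%N by rewrite -ltnS.
rewrite !hornerE/= -[X in _ = _ * _ ^+ X](subnK kn) exprD -[- k%:R]mulN1r exprMn.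
by move: (k%:R ^+ k) (k%:R ^+ (n - k)) => y z; ring.
Qed.

Lemma horner0_abel_rhs n : (r n).[0] = n`!%:R.
Proof.
rewrite /r horner_sum big_ord_recr/= subnn expr0 !hornerE ffactnn.
rewrite big1 ?add0r// => k _; rewrite !hornerE expr0n subn_eq0.
by rewrite leqNgt ltn_ord mulr0.
Qed.

Lemma deriv_inj (u v : {poly R}) : u^`() = v^`() -> u.[0] = v.[0] -> u = v.
Proof.
move=> uv uv0; apply/polyP => -[|i]; first by rewrite -!horner_coef0.
have := congr1 (fun w : {poly R} => w`_i) uv; rewrite /= !coef_deriv.
by move/eqP; rewrite eqr_pMn2r// => /eqP.
Qed.

Lemma abel_cauchy n (z : R) :
  \sum_(k < n.+1) 'C(n, k)%:R * k%:R ^+ k * (z - k%:R) ^+ (n - k) =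
  \sum_(k < n.+1) (n ^_ k)%:R * z ^+ (n - k).
Proof.
have /(congr1 (fun w : {poly R} => w.[z])) : q n = r n.
  elim: n => [|n IH]; last first.
    apply: deriv_inj; last by rewrite horner0_abel_lhs horner0_abel_rhs.
    by rewrite deriv_abel_lhs deriv_abel_rhs IH.
  by rewrite /q /r !big_ord1/= subnn !expr0 bin0 ffactn0 mulr1.
rewrite /q /r !horner_sum => E.
by under eq_bigr do rewrite -[_ - _]hornerXsubC -horner_exp -hornerZ; rewrite E;
  apply: eq_bigr => k _; rewrite !hornerE.
Qed.

Let a n k : R := \prod_(j < k) (1 - j%:R / n%:R).

(** This is [abel_cauchy] at [z = n], divided by [n ^ n]. The product [a n k] equals
    [n ^_ k / n ^ k], the probability that [k] uniform draws from [n] values are distinct, so the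
    sum is one plus Ramanujan's Q-function, of order [sqrt n]. *)
Lemma mlf_sumE n : (0 < n)%N ->
  \sum_(k < n.+1) 'C(n, k)%:R * (k%:R / n%:R) ^+ k * (1 - k%:R / n%:R) ^+ (n - k)
  = \sum_(k < n.+1) a n k.
Proof.
move=> n0; have n0' : n%:R != 0 :> R by rewrite pnatr_eq0 -lt0n.
transitivity ((n%:R : R) ^- n * \sum_(k < n.+1) 'C(n, k)%:R * k%:R ^+ k *
    (n%:R - k%:R) ^+ (n - k)).
  rewrite mulr_sumr; apply: eq_bigr => k _.
  have kn : (k <= n)%N by rewrite -ltnS.
  have -> : 1 - k%:R / n%:R = (n%:R - k%:R) / n%:R :> R by field.
  have -> : n%:R ^- n = n%:R^-1 ^+ k * n%:R^-1 ^+ (n - k) :> R.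
    by rewrite -exprD subnKC// exprVn.
  rewrite !exprMn; move: (k%:R ^+ k) (n%:R^-1 ^+ k) => y z; ring.
rewrite abel_cauchy mulr_sumr; apply: eq_bigr => k _.
have kn : (k <= n)%N by rewrite -ltnS.
have -> : n%:R ^- n * ((n ^_ k)%:R * n%:R ^+ (n - k)) =
    (n ^_ k)%:R / n%:R ^+ k :> R.
  rewrite -[X in n%:R ^- X](subnKC kn) exprD; field.
  by rewrite !expf_neq0.
rewrite /a; elim: (nat_of_ord k) kn => [|i IH] ik.
  by rewrite ffactn0 big_ord0 mul1r expr0 invr1.
rewrite big_ord_recr/= -IH; last exact: ltnW.
rewrite ffactnSr natrM natrB; last exact: ltnW.
by rewrite exprS; field; rewrite n0' expf_neq0.
Qed.
End abel.

(* Write [a k] for the product of [1 - j / n] over [j < k]. Since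
   [k * a k = n * (a k - a k.+1)], the terms beyond [m] sum to at most
   [n * a m / m]; take [m] next to [sqrt n]. *)
Lemma mlf_sum_le (R : realType) n : (1 < n)%N ->
  \sum_(k < n.+1) 'C(n, k)%:R * (k%:R / n%:R) ^+ k * (1 - k%:R / n%:R) ^+ (n - k)
  <= 2 * Num.sqrt n%:R :> R.
Proof.
move=> n1; rewrite mlf_sumE; last exact: ltnW.
set s := Num.sqrt _; pose a k : R := \prod_(j < k) (1 - j%:R / n%:R).
have n0 : 0 < n%:R :> R by rewrite ltr0n ltnW.
have s1 : 1 < s by rewrite -sqrtr1 ltr_sqrt// ltr1n.
have sn : s ^+ 2 = n%:R by rewrite sqr_sqrtr// ltW.
have aS k : a k.+1 = a k * (1 - k%:R / n%:R) by rewrite /a big_ord_recr.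
have a0 k : (k <= n)%N -> 0 <= a k <= 1.
  elim: k => [|k IH] kn; first by rewrite /a big_ord0 ler01 lexx.
  have /andP[ak0 ak1] := IH (ltnW kn); rewrite aS.
  have k1 : k%:R / n%:R <= 1 :> R by rewrite ler_pdivrMr// mul1r ler_nat ltnW.
  have k0 : 0 <= k%:R / n%:R :> R by rewrite divr_ge0// ltW.
  apply/andP; split; first by rewrite mulr_ge0// subr_ge0.
  by rewrite mulr_ile1// ?subr_ge0// lerBlDr lerDl.
pose m := (Num.truncn s).+1.
have /andP[ms sm] : (Num.truncn s)%:R <= s < m%:R.
  by rewrite truncn_itv// ltW// (lt_trans _ s1).
have m2 : (2 <= m)%N by rewrite ltnS truncn_gt0 ltW.
have mn : (m <= n)%N.
  rewrite truncn_lt_nat; last by rewrite ltW// (lt_trans _ s1).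
  by rewrite -sn expr2 ltr_pMl// (lt_trans _ s1).
have m0 : 0 < m%:R :> R by rewrite ltr0n.
(* [a] decreases and [a 2 = 1 - 1 / n]. The gain of [1 / n] becomes the [- 1] in [n * a m <= n - 1],
   which pays for rounding [s] up to the integer [m]. *)
have am : a m <= 1 - n%:R^-1.
  move: m2 mn {ms sm m0}; move: m => k; elim: k => // k IH.
  rewrite leq_eqVlt => /orP[/eqP[<-] _|k2 kn].
    by rewrite /a big_ord_recr big_ord1/= mul0r subr0 !mul1r.
  apply: le_trans (IH _ (ltnW kn)); last by rewrite -ltnS.
  rewrite aS ler_piMr//; first by have /andP[] := a0 _ (ltnW kn).
have tail i : (m <= i <= n.+1)%N ->
    m%:R * (\sum_(m <= k < i) a k) <= n%:R * (a m - a i).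
  elim: i => [|i IH]; first by case/andP.
  case/andP; rewrite leq_eqVlt => /orP[/eqP<- _|mi iN].
    by rewrite big_geq// mulr0 subrr mulr0.
  rewrite big_nat_recr//= mulrDr.
  have := IH; rewrite -ltnS mi ltnW// => /(_ isT) {}IH.
  have aE : n%:R * (a m - a i.+1) = n%:R * (a m - a i) + i%:R * a i.
    by rewrite aS; field; rewrite gt_eqF.
  rewrite aE lerD// ler_wpM2r//; last by rewrite ler_nat -ltnS.
  by have /andP[] := a0 i iN.
have an1 : a n.+1 = 0.
  by rewrite aS divff ?gt_eqF// subrr mulr0.
rewrite -/(a _) -(big_mkord xpredT a) (@big_cat_nat _ _ _ m)//=; last exact: leqW.
have h1 : \sum_(0 <= k < m) a k <= m%:R.
  rewrite -[X in _ <= X]mulr1 mulr_natl -[m in X in _ <= X]subn0 -sumr_const_nat.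
  rewrite big_nat [leRHS]big_nat; apply: ler_sum => k /andP[_ km].
  by have /andP[] := a0 k (ltnW (leq_trans km mn)).
have := tail n.+1; rewrite leqW// leqnn an1 subr0 => /(_ isT) h2.
rewrite -(ler_pM2l m0) mulrDr.
have h3 : n%:R * a m <= n%:R - 1.
  by apply: le_trans (ler_wpM2l (ltW n0) am) _; rewrite mulrBr mulr1 divff ?gt_eqF.
have h4 : m%:R * (\sum_(0 <= k < m) a k) <= m%:R ^+ 2 by rewrite expr2 ler_pM2l.
(* As [s ^ 2 = n], this says [m ^ 2 + n - 1 <= 2 m s]; the left side bounds [m] times the whole
   sum. *)
have h5 : (m%:R - s) ^+ 2 <= 1.
  have : 0 <= m%:R - s <= 1.
    by rewrite subr_ge0 ltW//= lerBlDl /m -natr1 lerD2r.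
  by nra.
by nra.
Qed.

(** * Product measures on tuples *)

(** Boxes are stable under intersection and generate, so uniqueness on a pi-system applies. The
    coordinates are an abstract finite family [p], to serve both a tuple and a pair of tuples; the
    exhaustion [g] is there for Lebesgue measure, and is constantly [setT] for probabilities. *)
Lemma box_measure_unique d d' (T : measurableType d) (Y : measurableType d')
    (R : realType) (I : finType) (p : I -> T -> Y)
    (mp : forall i, measurable_fun setT (p i))
    (gen : forall G : set (set T),
      (forall i B, measurable B -> G (p i @^-1` B)) -> measurable `<=` <<s G >>)
    (g : (set Y)^nat) (mg : forall k, measurable (g k))
    (ndg : nondecreasing_seq g) (gT : \bigcup_k g k = setT)
    (m1 m2 : {measure set T -> \bar R}) :
  (forall k, m1 [set x | forall i, g k (p i x)] < +oo)%E ->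
  (forall B : I -> set Y, (forall i, measurable (B i)) ->
    m1 [set x | forall i, B i (p i x)] = m2 [set x | forall i, B i (p i x)]) ->
  forall A, measurable A -> m1 A = m2 A.
Proof.
move=> m1g m12.
pose G := [set A | exists2 B : I -> set Y, (forall i, measurable (B i)) &
  A = [set x | forall i, B i (p i x)]].
have mG : G `<=` measurable.
  move=> _ [B mB ->].
  rewrite (_ : mkset _ = \bigcap_(i in [set: I]) (p i @^-1` B i)).
    apply: fin_bigcap_measurable; first exact: finite_finset.
    by move=> i _; rewrite -[X in measurable X]setTI; exact: mp.
  by apply/seteqP; split=> [x /= h i _|x /= h i]; exact: h.
apply: (measure_unique G (fun k => [set x | forall i, g k (p i x)])).
- apply/seteqP; split; last first.
    apply: smallest_sub => //; exact: sigma_algebra_measurable.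
  apply: gen => i B mB; exists (fun j => if j == i then B else setT).
    by move=> j; case: ifP.
  apply/seteqP; split => x /=; first by move=> Bx j; case: eqP => // ->.
  by move/(_ i); rewrite eqxx.
- move=> _ _ [B mB ->] [C mC ->]; exists (fun i => B i `&` C i).
    by move=> i; exact: measurableI.
  by apply/seteqP; split=> x /=; [case=> h1 h2 i; split|move=> h; split => i; case: (h i)].
- by move=> k; exists (fun=> g k).
- apply/seteqP; split=> // x _.
  have /choice[N hN] : forall i, exists k, g k (p i x).
    move=> i; have : setT (p i x) by []; rewrite -gT => -[k _ ?]; by exists k.
  exists (\max_i N i)%N => //= i.
  have /subsetPset := ndg _ _ (leq_bigmax i : (N i <= \max_i N i)%N).
  by apply; exact: hN.
- by move=> _ [B mB ->]; exact: m12.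
- exact: m1g.
Qed.

Section tuple_unique.
Context d (Y : measurableType d) (R : realType) (n : nat).

Lemma tuple_measure_unique (g : (set Y)^nat) (mg : forall k, measurable (g k))
    (ndg : nondecreasing_seq g) (gT : \bigcup_k g k = setT)
    (m1 m2 : {measure set (n.-tuple Y) -> \bar R}) :
  (forall k, m1 [set x | forall i, g k (tnth x i)] < +oo)%E ->
  (forall B : 'I_n -> set Y, (forall i, measurable (B i)) ->
    m1 [set x | forall i, B i (tnth x i)] = m2 [set x | forall i, B i (tnth x i)]) ->
  forall A, measurable A -> m1 A = m2 A.
Proof.
apply: (@box_measure_unique _ _ _ _ _ _ (fun i x => tnth x i)) => //.
  by move=> i; exact: measurable_tnth.
move=> G hG A mA.
(* The identity out of the sigma-algebra generated by [G] is measurable because each coordinate is;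
   preimages under it give the required inclusion. *)
have : measurable_fun [set: g_sigma_algebraType G] (fun x => x : n.-tuple Y).
  apply/measurable_fun_tnthP => i _ B mB; rewrite setTI.
  by apply: sub_sigma_algebra; exact: hG.
by move=> /(_ measurableT _ mA); rewrite setTI preimage_id.
Qed.

Lemma tuple_prob_unique (m1 m2 : {measure set (n.-tuple Y) -> \bar R}) :
  (m1 setT < +oo)%E ->
  (forall B : 'I_n -> set Y, (forall i, measurable (B i)) ->
    m1 [set x | forall i, B i (tnth x i)] = m2 [set x | forall i, B i (tnth x i)]) ->
  forall A, measurable A -> m1 A = m2 A.
Proof.
move=> m1T; apply: (@tuple_measure_unique (fun=> setT)) => //.
  by rewrite bigcup_const//; exists 0%N.
move=> _; rewrite (_ : mkset _ = setT)//.
by apply/seteqP; split.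
Qed.

Lemma tuple2_prob_unique
    (m1 m2 : {measure set (n.-tuple Y * n.-tuple Y)%type -> \bar R}) :
  (m1 setT < +oo)%E ->
  (forall B C : 'I_n -> set Y, (forall i, measurable (B i)) ->
    (forall i, measurable (C i)) ->
    m1 ([set x | forall i, B i (tnth x i)] `*` [set x | forall i, C i (tnth x i)]) =
    m2 ([set x | forall i, B i (tnth x i)] `*` [set x | forall i, C i (tnth x i)])) ->
  forall A, measurable A -> m1 A = m2 A.
Proof.
move=> m1T m12.
pose p (b : 'I_n + 'I_n) (x : n.-tuple Y * n.-tuple Y) :=
  match b with inl i => tnth x.1 i | inr i => tnth x.2 i end.
apply: (@box_measure_unique _ _ _ _ _ _ p _ _ (fun=> setT)) => //.
- by case=> i; apply: (measurableT_comp (measurable_tnth i)).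
- move=> G hG A mA.
  have : measurable_fun [set: g_sigma_algebraType G]
      (fun x => x : n.-tuple Y * n.-tuple Y).
    apply/measurable_fun_pairP; split; apply/measurable_fun_tnthP => i _ B mB; rewrite setTI;
    apply: sub_sigma_algebra.
      exact: (hG (inl i)).
    exact: (hG (inr i)).
  by move=> /(_ measurableT _ mA); rewrite setTI preimage_id.
- by rewrite bigcup_const//; exists 0%N.
- move=> _; rewrite (_ : mkset _ = setT)//.
  by apply/seteqP; split.
- move=> B mB; have := m12 (B \o inl) (B \o inr) (fun i => mB _) (fun i => mB _).
  rewrite (_ : _ `*` _ = [set x | forall i, B i (p i x)])//.
  apply/seteqP; split=> -[x y] /=; first by move=> [h1 h2] [i|i]; [exact: h1|exact: h2].
  by move=> h; split=> i; [exact: (h (inl i))|exact: (h (inr i))].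
Qed.
End tuple_unique.

Lemma measurable_box d (Y : measurableType d) n (B : 'I_n -> set Y) :
  (forall i, measurable (B i)) ->
  measurable [set x : n.-tuple Y | forall i, B i (tnth x i)].
Proof.
move=> mB.
rewrite (_ : mkset _ = \bigcap_(i in [set: 'I_n]) ((fun x => tnth x i) @^-1` B i)).
  apply: fin_bigcap_measurable; first exact: finite_finset.
  by move=> i _; rewrite -[X in measurable X]setTI; exact: measurable_tnth.
by apply/seteqP; split=> [x /= h i _|x /= h i]; exact: h.
Qed.

Lemma ge0_integral_law d d' (T : measurableType d) (T' : measurableType d')
    (R : realType) (m : {measure set T -> \bar R}) (m' : {measure set T' -> \bar R})
    (phi : T -> T') (f : T' -> \bar R) :
  measurable_fun setT phi ->
  (forall A, measurable A -> m (phi @^-1` A) = m' A) ->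
  measurable_fun setT f -> (forall y, 0 <= f y)%E ->
  (\int[m]_x f (phi x) = \int[m']_y f y)%E.
Proof.
move=> mphi mm' mf f0.
rewrite -[LHS](@ge0_integral_pushforward _ _ _ _ _ _ mphi m setT)//.
by apply: eq_measure_integral => A mA _; exact: mm'.
Qed.

Lemma measurable_fun_coord d (X : measurableType d) (R : realType) n
    (f : 'I_n -> X -> R) : (forall i, measurable_fun setT (f i)) ->
  forall i, measurable_fun [set: n.-tuple X] (fun x => f i (tnth x i)).
Proof. by move=> mf i; apply: (measurableT_comp (mf i)); exact: measurable_tnth. Qed.

(** [mun] is known only through its values on boxes, so the product structure is rebuilt at each
    induction step: the law [mun'] of the tail satisfies the same box hypothesis, and [mun] is the
    image of [mu \x mun'] under cons, after which Tonelli separates the head. *)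
Lemma integral_prod_tuple d (X : measurableType d) (R : realType)
    (mu : probability X R) n (mun : probability (n.-tuple X) R)
    (hmun : forall B : 'I_n -> set X, (forall i, measurable (B i)) ->
     mun [set x | forall i, B i (tnth x i)] = (\prod_(i < n) mu (B i))%E)
    (f : 'I_n -> X -> R) :
  (forall i, measurable_fun setT (f i)) -> (forall i z, 0 <= f i z) ->
  (\int[mun]_x (\prod_(i < n) f i (tnth x i))%:E =
   \prod_(i < n) \int[mu]_z (f i z)%:E)%E.
Proof.
elim: n mun hmun f => [|n IH] mun hmun f mf f0.
  under eq_integral do rewrite big_ord0.
  by rewrite integral_cst// mul1e big_ord0; exact: (probability_setT mun).
pose b0 (x : n.+1.-tuple X) : n.-tuple X := [tuple of behead x].
have mb : measurable_fun [set: n.+1.-tuple X] b0.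
  exact: measurable_behead.
pose b : {mfun n.+1.-tuple X >-> n.-tuple X} :=
  HB.pack b0 (isMeasurableFun.Build _ _ _ _ _ mb).
pose mun' : probability (n.-tuple X) R := distribution mun b.
have hmun' B : (forall i, measurable (B i)) ->
    mun' [set x | forall i, B i (tnth x i)] = (\prod_(i < n) mu (B i))%E.
  move=> mB; pose B' i := if unlift ord0 i is Some j then B j else setT.
  have mB' i : measurable (B' i) by rewrite /B'; case: unlift.
  have := hmun B' mB'; rewrite big_ord_recl/= {2}/B' unlift_none (probability_setT mu) mul1e.
  under eq_bigr do rewrite /B' liftK.
  move=> <-; rewrite /mun' /distribution /pushforward/=; congr (mun _).
  apply/seteqP; split=> x /=.
    move=> h i; rewrite /B'; case: unliftP => [j ->|//].
    by have := h j; rewrite [in X in _ -> X](tuple_eta x) tnthS.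
  move=> h j; have := h (lift ord0 j); rewrite /B' liftK.
  by rewrite [in X in X -> _](tuple_eta x) tnthS.
pose phi (p : X * n.-tuple X) := [the n.+1.-tuple X of p.1 :: p.2].
have mphi : measurable_fun setT phi by apply: measurable_cons.
have law A : measurable A -> (mu \x mun')%E (phi @^-1` A) = mun A.
  move=> mA.
  apply: (@tuple_prob_unique _ _ _ _ (pushforward (mu \x mun')%E phi)) => //.
    rewrite /= /pushforward preimage_setT -setXTT product_measure1E//.
    suff : (mu setT * mun' setT < +oo)%E by [].
    by rewrite (probability_setT mu) (probability_setT mun') mule1 ltry.
  move=> B mB; apply: etrans (esym (hmun B mB)); rewrite big_ord_recl.
  rewrite -(hmun' (fun i => B (lift ord0 i)))//.
  transitivity ((mu \x mun')%E
    (B ord0 `*` [set x | forall i, B (lift ord0 i) (tnth x i)])); last first.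
    apply: product_measure1E => //.
    exact: (measurable_box _ _ _ (fun i => B (lift ord0 i))).
  apply: (congr1 (mu \x mun')%E); apply/seteqP; split=> -[x y] /=.
    by move=> h; split; [have := h ord0|move=> i; have := h (lift ord0 i); rewrite tnthS].
  move=> [h1 h2] i; case: (unliftP ord0 i) => [j ->|->]; last exact: h1.
  by rewrite tnthS; exact: h2.
have mprod k (g : 'I_k -> X -> R) : (forall i, measurable_fun setT (g i)) ->
    measurable_fun [set: k.-tuple X] (fun x => \prod_(i < k) g i (tnth x i)).
  by move=> mg; apply: measurable_prod => i _; exact: measurable_fun_coord.
rewrite -(@ge0_integral_law _ _ _ _ _ (mu \x mun')%E mun phi) //; last 2 first.
- by apply/measurable_EFinP; exact: mprod.
- by move=> x; rewrite lee_fin prodr_ge0.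
rewrite fubini_tonelli1; last 2 first.
- apply: (@measurableT_comp _ _ _ _ _ _
    (fun x : n.+1.-tuple X => (\prod_(i < n.+1) f i (tnth x i))%:E) _ phi) => //.
  by apply/measurable_EFinP; exact: mprod.
- by move=> x; rewrite lee_fin prodr_ge0.
have phiE x y : \prod_(i < n.+1) f i (tnth (phi (x, y)) i) =
    f ord0 x * \prod_(i < n) f (lift ord0 i) (tnth y i).
  by rewrite big_ord_recl/=; congr (_ * _); apply: eq_bigr => i _; rewrite tnthS.
rewrite /fubini_F.
under eq_integral => x _.
  under eq_integral => y _.
    rewrite phiE EFinM; over.
  rewrite ge0_integralZl//; last 3 first.
  - by apply/measurable_EFinP; exact: (mprod _ (fun i => f (lift ord0 i))).
  - by move=> y _; rewrite lee_fin prodr_ge0.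
  - by rewrite lee_fin.
  rewrite (IH mun' hmun' (fun i => f (lift ord0 i)))//.
  over.
rewrite ge0_integralZr//; last 3 first.
- exact/measurable_EFinP.
- by move=> x _; rewrite lee_fin.
- by apply: prode_ge0 => i _; apply: integral_ge0 => z _; rewrite lee_fin.
by rewrite big_ord_recl.
Qed.

(** * The moment generating function of the binary relative entropy *)

Section kl.
Context {R : realType}.
Implicit Types s t y : R.

Lemma expR_convex y (a b : R) : 0 <= y <= 1 ->
  expR (y * a + (1 - y) * b) <= y * expR a + (1 - y) * expR b.
Proof.
move=> /andP[y0 y1].
have h (c u : R) : expR c * (1 + (u - c)) <= expR u.
  by rewrite -[in leRHS](subrKC c u) expRD ler_pM2l ?expR_gt0// expR_ge1Dx.
have ha := ler_wpM2l y0 (h (y * a + (1 - y) * b) a).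
set c := y * a + (1 - y) * b in ha *.
have hb : (1 - y) * (expR c * (1 + (b - c))) <= (1 - y) * expR b.
  by rewrite ler_wpM2l// subr_ge0.
apply: le_trans (lerD ha hb); rewrite le_eqVlt; apply/orP; left; apply/eqP.
by rewrite {2 3 4 5}/c; ring.
Qed.

Lemma klb_itv_oo s t : 0 < t < 1 ->
  klb s t = (s * ln (s / t) + (1 - s) * ln ((1 - s) / (1 - t)))%:E.
Proof.
move=> /andP[t0 t1]; rewrite /klb /xlogxy (gt_eqF t0) (subr_eq0 1 t) (gt_eqF t1).
by rewrite EFinD; congr (_ + _)%E; case: eqP => // ->; rewrite mul0r.
Qed.

Lemma klb_sym s t : klb (1 - s) (1 - t) = klb s t.
Proof. by rewrite /klb !subKr addeC. Qed.

(** [k / n] is the maximum likelihood parameter for [k] successes out of [n]. Calculus is avoided by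
    applying [u <= v * exp (u / v - 1)] to each factor, with [v] the value at [k / n]: the exponents
    then add up to 0. *)
Lemma mlf_le (p : R) k n : 0 <= p <= 1 -> (k <= n)%N -> (0 < n)%N ->
  p ^+ k * (1 - p) ^+ (n - k) <=
  (k%:R / n%:R) ^+ k * (1 - k%:R / n%:R) ^+ (n - k).
Proof.
move=> /andP[p0 p1] kn n0.
have n0' : 0 < n%:R :> R by rewrite ltr0n.
have [->|k0] := posnP k.
  by rewrite mul0r !expr0 !mul1r subr0 expr1n exprn_ile1// ?subr_ge0// lerBlDr lerDl.
have [->|kn'] := eqVneq k n.
  by rewrite subnn divff ?gt_eqF// !expr0 !mulr1 expr1n exprn_ile1.
have {kn'}kn' : (k < n)%N by rewrite ltn_neqAle kn'.
have a0 : 0 < k%:R / n%:R :> R by rewrite divr_gt0// ltr0n.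
have b0 : 0 < 1 - k%:R / n%:R :> R by rewrite subr_gt0 ltr_pdivrMr// mul1r ltr_nat.
set a := k%:R / n%:R in a0 b0 *.
have h (u v : R) m : 0 < v -> 0 <= u -> u ^+ m <= v ^+ m * expR (m%:R * (u / v - 1)).
  move=> v0 u0; rewrite -[X in m%:R * X]addr0 expRM_natl -exprMn; apply: lerXn2r => //.
  - by rewrite nnegrE mulr_ge0 ?expR_ge0 ?ltW.
  - rewrite -ler_pdivrMl// mulrC addr0; apply: le_trans (expR_ge1Dx _).
    by rewrite addrC subrK.
have q0 : 0 <= 1 - p by rewrite subr_ge0.
apply: le_trans (ler_pM _ _ (h _ _ k a0 p0) (h _ _ (n - k)%N b0 q0)) _.
- by rewrite exprn_ge0.
- by rewrite exprn_ge0.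
rewrite mulrACA -expRD [X in expR X](_ : _ = 0) ?expR0 ?mulr1//.
rewrite natrB//.
have E : k%:R = a * n%:R by rewrite /a divfK// gt_eqF.
rewrite E; move: a0 b0; move: a {E h} => a a0 b0; field.
by rewrite gt_eqF// gt_eqF.
Qed.

(* With [p = s], each factor [(p / t) ^ y i * ((1 - p) / (1 - t)) ^ (1 - y i)] is
   at most its chord in [y i]; expanding the product over subsets [J] and
   maximizing each term over [p] removes the dependence of [p] on [y]. *)
Lemma expR_kl_le n (y : 'I_n -> R) s t : (0 < n)%N -> 0 < t < 1 ->
  (forall i, 0 <= y i <= 1) ->
  s = n%:R^-1 * \sum_(i < n) y i ->
  expR (n%:R * (s * ln (s / t) + (1 - s) * ln ((1 - s) / (1 - t)))) <=
  \sum_(J : {set 'I_n}) (\prod_(i < n) (if i \in J then y i else 1 - y i)) *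
    ((#|J|%:R / n%:R) ^+ #|J| * (1 - #|J|%:R / n%:R) ^+ (n - #|J|) /
     (t ^+ #|J| * (1 - t) ^+ (n - #|J|))).
Proof.
move=> n0 /andP[t0 t1] y01 sE.
have n0' : 0 < n%:R :> R by rewrite ltr0n.
have t1' : 0 < 1 - t by rewrite subr_gt0.
have {}sE : n%:R * s = \sum_(i < n) y i by rewrite sE mulrA divff ?mul1r// gt_eqF.
have y0 i : 0 <= y i by have /andP[] := y01 i.
have y1 i : 0 <= 1 - y i by rewrite subr_ge0; have /andP[] := y01 i.
have s0 : 0 <= s by rewrite -(pmulr_rge0 _ n0') sE sumr_ge0.
have n1s : n%:R * (1 - s) = \sum_(i < n) (1 - y i).
  by rewrite sumrB sumr_const card_ord mulrBr sE mulr1.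
have s1 : 0 <= 1 - s by rewrite -(pmulr_rge0 _ n0') n1s sumr_ge0.
rewrite mulrDr !mulrA sE n1s !mulr_suml -big_split/= expR_sum.
apply: (@le_trans _ _ (\prod_(i < n) (y i * (s / t) + (1 - y i) * ((1 - s) / (1 - t))))).
  apply: ler_prod => i _; rewrite expR_ge0/=.
  have yz (z : 'I_n -> R) : (forall i, 0 <= z i) -> \sum_(i < n) z i = 0 -> z i = 0.
    by move=> z0 /eqP; rewrite psumr_eq0// => /allP/(_ i); rewrite mem_index_enum => /(_ isT)/eqP.
  (* At [s = 0] or [s = 1] one logarithm is taken at 0, where its default value 0 breaks
     [expR (ln u) = u]. There every [y i] equals [s], so the coefficient of that logarithm
     vanishes. *)
  have [s00|sn0] := eqVneq s 0.
    have -> : y i = 0 by apply: (yz y) => //; rewrite -sE s00 mulr0.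
    by rewrite s00 !mul0r !add0r subr0 !mul1r lnK// posrE invr_gt0.
  have [s11|sn1] := eqVneq (1 - s) 0.
    have yi : 1 - y i = 0 by apply: (yz (fun i => 1 - y i)) => //; rewrite -n1s s11 mulr0.
    have -> : y i = 1 by rewrite -[y i](subKr 1) yi subr0.
    by rewrite s11 subrr !mul0r !addr0 !mul1r lnK// posrE divr_gt0// lt0r sn0.
  apply: le_trans (expR_convex _ _ _ _) _; first exact: y01.
  by rewrite !lnK// posrE divr_gt0// lt0r ?sn0 ?sn1.
rewrite bigA_distr/=; apply: ler_sum => J _.
have -> : \prod_i (if i \in J then y i * (s / t) else (1 - y i) * ((1 - s) / (1 - t))) =
  (\prod_(i < n) (if i \in J then y i else 1 - y i)) *
    (s ^+ #|J| * (1 - s) ^+ (n - #|J|) / (t ^+ #|J| * (1 - t) ^+ (n - #|J|))).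
  transitivity (\prod_(i < n) ((if i \in J then y i else 1 - y i) *
      (if i \in J then s / t else (1 - s) / (1 - t)))).
    by apply: eq_bigr => i _; case: ifP.
  rewrite big_split/=; congr (_ * _).
  rewrite (bigID (mem J))/= (eq_bigr (fun=> s / t)); last by move=> i ->.
  rewrite [X in _ * X](eq_bigr (fun=> (1 - s) / (1 - t))); last by move=> i /negbTE ->.
  rewrite !prodr_const; have -> : #|[pred i | i \notin J]| = (n - #|J|)%N.
    have := cardC J; rewrite card_ord => cJ; apply/eqP; rewrite -(eqn_add2l #|J|).
    rewrite subnKC; last by have := max_card (mem J); rewrite card_ord.
    by rewrite -[X in _ == X]cJ; apply/eqP; congr (_ + _)%N; apply: eq_card.
  by rewrite !exprMn invfM !exprVn mulrACA.
rewrite ler_wpM2l//.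
  by apply: prodr_ge0 => i _; case: ifP.
rewrite ler_pM2r; last by rewrite invr_gt0 mulr_gt0// exprn_gt0.
apply: mlf_le => //; first by rewrite s0 -subr_ge0.
by have := max_card (mem J); rewrite card_ord.
Qed.

Lemma sum_set_card n (F : nat -> R) :
  \sum_(J : {set 'I_n}) F #|J| = \sum_(k < n.+1) 'C(n, k)%:R * F k.
Proof.
have cJ (J : {set 'I_n}) : (#|J| < n.+1)%N.
  by rewrite ltnS -[X in (_ <= X)%N](card_ord n) max_card.
rewrite (partition_big (fun J : {set 'I_n} => Ordinal (cJ J)) xpredT)//=.
apply: eq_bigr => k _; rewrite (eq_bigr (fun=> F k)); last by move=> J /eqP <-.
rewrite sumr_const mulr_natl -[X in 'C(X, k)](card_ord n) -card_draws; congr (_ *+ _).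
by apply: eq_card => J; rewrite !inE unfold_in.
Qed.

Lemma ln_le_subr1 (x : R) : 0 < x -> ln x <= x - 1.
Proof.
by move=> x0; rewrite lerBrDl -[leRHS](lnK x0) expR_ge1Dx.
Qed.

(** Each of the two terms is at least the difference of its arguments, by [ln x <= x - 1], and the
    two differences cancel. *)
Lemma klb_ge0 s t : 0 <= s <= 1 -> 0 <= t <= 1 -> (0 <= klb s t)%E.
Proof.
have h (u v : R) : 0 <= u -> 0 <= v -> ((u - v)%:E <= xlogxy u v)%E.
  rewrite le0r => /orP[/eqP->|u0] v0; rewrite /xlogxy.
    by rewrite eqxx sub0r lee_fin oppr_le0.
  rewrite gt_eqF//; case: eqP => [|/eqP vn0]; first by rewrite leey.
  have {vn0}v0 : 0 < v by rewrite lt0r vn0.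
  rewrite lee_fin -[u / v]invrK invf_div lnV ?posrE ?divr_gt0//.
  have := ln_le_subr1 _ (divr_gt0 v0 u0) => /(ler_wpM2l (ltW u0)).
  rewrite mulrBr mulrCA divff ?gt_eqF// !mulr1 mulrN; lra.
move=> /andP[s0 s1] /andP[t0 t1]; rewrite /klb.
have h2 : ((1 - s - (1 - t))%:E <= xlogxy (1 - s) (1 - t))%E by apply: h; rewrite subr_ge0.
apply: le_trans (leeD (h _ _ s0 t0) h2); rewrite -EFinD lee_fin; lra.
Qed.

Lemma klb00 : klb (0 : R) 0 = 0%E.
Proof. by rewrite /klb /xlogxy eqxx add0e subr0 oner_eq0 divr1 ln1 mulr0. Qed.

Lemma measurable_klb d (T : measurableType d) (f g : T -> R) :
  (forall x, 0 <= f x <= 1) -> (forall x, 0 <= g x <= 1) ->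
  measurable_fun setT f -> measurable_fun setT g ->
  measurable_fun setT (fun x => klb (f x) (g x)).
Proof.
move=> f01 g01 mf mg.
have h (u v : T -> R) : (forall x, 0 <= u x) -> (forall x, 0 <= v x) ->
    measurable_fun setT u -> measurable_fun setT v ->
    measurable_fun setT (fun x => xlogxy (u x) (v x)).
  move=> u0 v0 mu mv.
  (* Away from the special values both arguments are positive, and splitting the logarithm removes
     the division from the measurability proof. *)
  rewrite (_ : (fun _ => _) = fun x => if u x == 0 then 0%E else
      if v x == 0 then +oo%E else (u x * (ln (u x) - ln (v x)))%:E); last first.
    apply/funext => x; rewrite /xlogxy; case: eqP => // /eqP ux; case: eqP => // /eqP vx.
    by rewrite lnM ?posrE ?invr_gt0 ?lt0r ?ux ?vx ?u0 ?v0// lnV// posrE lt0r vx v0.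
  apply: measurable_fun_ifT => //.
    exact: measurable_fun_eqr.
  apply: measurable_fun_ifT => //; first exact: measurable_fun_eqr.
  apply/measurable_EFinP; apply: measurable_funM => //.
  by apply: measurable_funB; apply: measurableT_comp => //.
have f0 x : 0 <= f x by have /andP[] := f01 x.
have g0 x : 0 <= g x by have /andP[] := g01 x.
have f1 x : 0 <= 1 - f x by rewrite subr_ge0; have /andP[] := f01 x.
have g1 x : 0 <= 1 - g x by rewrite subr_ge0; have /andP[] := g01 x.
by apply: emeasurable_funD; apply: h => //; exact: measurable_funB.
Qed.

Lemma measurable_expeR_ge0 d (T : measurableType d) (f : T -> \bar R) :
  measurable_fun setT f -> (forall x, 0 <= f x)%E ->
  measurable_fun setT (fun x => expeR (f x)).
Proof.
move=> mf f0; rewrite (_ : (fun _ => _) = er_map expR \o f).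
  by apply: measurableT_comp mf; exact: (@measurable_er_map _ T _ _ (@measurable_expR R)).
by apply/funext => x /=; have := f0 x; case: (f x).
Qed.
End kl.

Lemma integral_prob_cst d (T : measurableType d) (R : realType)
  (P : probability T R) (r : R) : (\int[P]_x r%:E = r%:E)%E.
Proof.
rewrite integral_cst// -[RHS]mule1; congr (_ * _)%E; exact: probability_setT.
Qed.

Section mean.
Context d (X : measurableType d) (R : realType) (mu : probability X R).
Variables (f : X -> R) (mf : measurable_fun setT f) (f01 : forall z, 0 <= f z <= 1).
Let f0 z : 0 <= f z. Proof. by have /andP[] := f01 z. Qed.
Let f1 z : f z <= 1. Proof. by have /andP[] := f01 z. Qed.
Let L := fine (\int[mu]_z (f z)%:E)%E.

Lemma mean01_fin_num : (\int[mu]_z (f z)%:E)%E \is a fin_num.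
Proof.
rewrite ge0_fin_numE; last by apply: integral_ge0 => z _; rewrite lee_fin.
apply: (@le_lt_trans _ _ (\int[mu]_z 1%:E)%E).
  apply: ge0_le_integral => //.
  - by move=> z _; rewrite lee_fin.
  - exact/measurable_EFinP.
  - by move=> z _; rewrite lee_fin.
by rewrite integral_prob_cst ltry.
Qed.

Lemma mean01_integral : (\int[mu]_z (f z)%:E)%E = L%:E.
Proof. by rewrite fineK// mean01_fin_num. Qed.

Lemma mean01_integralC : (\int[mu]_z (1 - f z)%:E)%E = (1 - L)%:E.
Proof.
have : (\int[mu]_z ((f z)%:E + (1 - f z)%:E) = 1)%E.
  under eq_integral do rewrite -EFinD subrKC.
  exact: integral_prob_cst.
rewrite ge0_integralD//; last 4 first.
- by move=> z _; rewrite lee_fin.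
- exact/measurable_EFinP.
- by move=> z _; rewrite lee_fin subr_ge0.
- by apply/measurable_EFinP; exact: measurable_funB.
rewrite mean01_integral => E; rewrite EFinB -[X in (X - _)%E]E.
by rewrite addeAC subee// add0e.
Qed.

Lemma mean01_itv : 0 <= L <= 1.
Proof.
apply/andP; split; first by rewrite fine_ge0// integral_ge0// => z _; rewrite lee_fin.
rewrite -subr_ge0 -lee_fin -mean01_integralC; apply: integral_ge0 => z _.
by rewrite lee_fin subr_ge0.
Qed.
End mean.

Section klmgf.
Context d (X : measurableType d) (R : realType) (mu : probability X R).
Variables (n : nat) (mun : probability (n.-tuple X) R).
Hypothesis hmun : forall B : 'I_n -> set X, (forall i, measurable (B i)) ->
     mun [set x | forall i, B i (tnth x i)] = (\prod_(i < n) mu (B i))%E.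
Hypothesis n1 : (1 < n)%N.

Lemma emp_mean_itv (f : X -> R) (x : n.-tuple X) : (forall z, 0 <= f z <= 1) ->
  0 <= n%:R^-1 * (\sum_(i < n) f (tnth x i)) <= 1.
Proof.
move=> f01; have n0 : 0 < n%:R :> R by rewrite ltr0n ltnW.
apply/andP; split.
  rewrite mulr_ge0 ?invr_ge0 ?(ltW n0)//; apply: sumr_ge0 => i _.
  by have /andP[] := f01 (tnth x i).
rewrite mulrC ler_pdivrMr// mul1r -[X in _ <= X%:R]card_ord -sumr_const.
by apply: ler_sum => i _; have /andP[] := f01 (tnth x i).
Qed.

Lemma measurable_emp_mean (f : X -> R) : measurable_fun setT f ->
  measurable_fun [set: n.-tuple X] (fun x => n%:R^-1 * (\sum_(i < n) f (tnth x i))).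
Proof.
move=> mf; apply: measurable_funM => //; apply: measurable_sum => i.
exact: (@measurable_fun_coord _ _ _ n (fun=> f)).
Qed.

Lemma measurable_kl_emp (f : X -> R) (L : R) : measurable_fun setT f ->
  (forall z, 0 <= f z <= 1) -> 0 <= L <= 1 ->
  measurable_fun [set: n.-tuple X]
   (fun x => expeR (n%:R%:E * klb (n%:R^-1 * (\sum_(i < n) f (tnth x i))) L)).
Proof.
move=> mf f01 L01; apply: measurable_expeR_ge0; last first.
  by move=> x; rewrite mule_ge0 ?lee_fin// klb_ge0// emp_mean_itv.
apply: emeasurable_funM => //; apply: measurable_klb => //.
- by move=> x; exact: emp_mean_itv.
- exact: measurable_emp_mean.
Qed.

Let kl_mgf_0 (f : X -> R) : measurable_fun setT f -> (forall z, 0 <= f z <= 1) ->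
  fine (\int[mu]_z (f z)%:E)%E = 0 ->
  (\int[mun]_x expeR (n%:R%:E * klb (n%:R^-1 * (\sum_(i < n) f (tnth x i))) 0) <= 1)%E.
Proof.
move=> mf f01 L0.
have mf' : measurable_fun setT (EFin \o f) by exact/measurable_EFinP.
have /(ae_eq_integral_abs mu measurableT mf')[N [mN N0 fN]] :
    (\int[mu]_z `|(EFin \o f) z| = 0)%E.
  rewrite (eq_integral (EFin \o f)); first by rewrite mean01_integral// L0.
  by move=> z _; rewrite gee0_abs// lee_fin; have /andP[] := f01 z.
rewrite -[leRHS](integral_prob_cst _ _ _ mun 1); apply: ae_ge0_le_integral => //.
- by move=> x _; exact: expeR_ge0.
- by apply: measurable_kl_emp => //; rewrite lexx ler01.
have mNc : measurable [set x : n.-tuple X | forall i, (~` N) (tnth x i)].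
  by apply: (measurable_box _ _ _ (fun=> ~` N)) => i; exact: measurableC.
exists (~` [set x | forall i, (~` N) (tnth x i)]); split.
- exact: measurableC.
- suff : mun (~` [set x | forall i, (~` N) (tnth x i)]) = 0%E by [].
  have E1 : mun (~` [set x | forall i, (~` N) (tnth x i)]) =
    (1 - mun [set x | forall i, (~` N) (tnth x i)])%E := probability_setC mun mNc.
  have E2 : mu (~` N) = (1 - mu N)%E := probability_setC mu mN.
  have E3 : mu N = 0%E := N0.
  by rewrite E1 (hmun (fun=> ~` N) (fun=> measurableC mN)) big1 ?subee// E2 E3 sube0.
- move=> x /= /not_implyP[_ h] hN; apply: h.
  rewrite big1 ?mulr0 ?klb00 ?mule0 ?expeR0// => i _.
  apply: contrapT => fi; apply: (hN i); apply: fN => /= h.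
  by apply: fi; have [] := h I.
Qed.

Let kl_mgf_oo (f : X -> R) L : measurable_fun setT f -> (forall z, 0 <= f z <= 1) ->
  fine (\int[mu]_z (f z)%:E)%E = L -> 0 < L < 1 ->
  (\int[mun]_x expeR (n%:R%:E * klb (n%:R^-1 * (\sum_(i < n) f (tnth x i))) L) <=
    (2 * Num.sqrt n%:R)%:E)%E.
Proof.
move=> mf f01 LE L01; have n0 : (0 < n)%N by exact: ltnW.
have /andP[L0 L1] := L01.
have f0 z : 0 <= f z by have /andP[] := f01 z.
have f1 z : 0 <= 1 - f z by rewrite subr_ge0; have /andP[] := f01 z.
pose c k : R := (k%:R / n%:R) ^+ k * (1 - k%:R / n%:R) ^+ (n - k).
pose D k : R := L ^+ k * (1 - L) ^+ (n - k).
pose g (J : {set 'I_n}) i z := if i \in J then f z else 1 - f z.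
have g0 J i z : 0 <= g J i z by rewrite /g; case: ifP.
have mg J i : measurable_fun setT (g J i).
  by rewrite /g; case: (i \in J) => //; exact: measurable_funB.
have cn (J : {set 'I_n}) : (#|J| <= n)%N.
  by rewrite -[X in (_ <= X)%N](card_ord n) max_card.
have D0 k : 0 < D k by rewrite mulr_gt0// exprn_gt0// subr_gt0.
have cD0 (J : {set 'I_n}) : 0 <= c #|J| / D #|J|.
  rewrite divr_ge0 ?(ltW (D0 _))// mulr_ge0// exprn_ge0// ?divr_ge0// subr_ge0.
  by rewrite ler_pdivrMr ?ltr0n// mul1r ler_nat.
have mprod J : measurable_fun [set: n.-tuple X] (fun x => \prod_(i < n) g J i (tnth x i)).
  by apply: measurable_prod => i _; exact: (@measurable_fun_coord _ _ _ n (g J)).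
apply: (@le_trans _ _ (\int[mun]_x (\sum_(J <- index_enum {set 'I_n})
    ((c #|J| / D #|J|)%:E * (\prod_(i < n) g J i (tnth x i))%:E)))%E).
  apply: ge0_le_integral => //.
  - by move=> x _; exact: expeR_ge0.
  - by apply: measurable_kl_emp => //; rewrite !ltW.
  - apply: emeasurable_sum => J; apply: emeasurable_funM => //.
    exact/measurable_EFinP.
  - move=> x _; rewrite klb_itv_oo// -EFinM/=.
    rewrite [leRHS](_ : _ = (\sum_(J : {set 'I_n}) (c #|J| / D #|J|) *
      (\prod_(i < n) g J i (tnth x i)))%:E) ?lee_fin; last by rewrite -sumEFin.
    apply: le_trans (expR_kl_le n (fun i => f (tnth x i)) _ L n0 L01 _ erefl) _ => //.
    by rewrite le_eqVlt; apply/orP; left; apply/eqP; apply: eq_bigr => J _; rewrite mulrC.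
rewrite ge0_integral_sum//; last 2 first.
- by move=> J; apply: emeasurable_funM => //; exact/measurable_EFinP.
- by move=> J x _; rewrite mule_ge0 ?lee_fin// prodr_ge0.
(* By independence the product attached to [J] has mean [D #|J|], which cancels the denominator: the
   bound no longer depends on [L]. *)
rewrite (eq_bigr (fun J : {set 'I_n} => (c #|J|)%:E)); last first.
  move=> J _; rewrite ge0_integralZl//; last 3 first.
  - exact/measurable_EFinP.
  - by move=> x _; rewrite lee_fin prodr_ge0.
  - by rewrite lee_fin.
  rewrite (integral_prod_tuple _ _ _ _ _ _ hmun)//.
  rewrite (eq_bigr (fun i => (if i \in J then L else 1 - L)%:E)); last first.
    move=> i _; rewrite /g; case: ifP => _.
      by rewrite mean01_integral// LE.
    by rewrite mean01_integralC// LE.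
  rewrite prodEFin -EFinM; congr (_%:E).
  have -> : \prod_i (if i \in J then L else 1 - L) = D #|J|.
    rewrite (bigID (mem J))/= (eq_bigr (fun=> L)); last by move=> i ->.
    rewrite [X in _ * X](eq_bigr (fun=> (1 - L))); last by move=> i /negbTE ->.
    rewrite !prodr_const /D; congr (_ * _ ^+ _).
    have := cardC J; rewrite card_ord => cJ; apply/eqP; rewrite -(eqn_add2l #|J|) subnKC//.
    by rewrite -[X in _ == X]cJ; apply/eqP; congr (_ + _)%N; apply: eq_card.
  by rewrite divfK// gt_eqF.
rewrite sumEFin lee_fin sum_set_card.
apply: le_trans (mlf_sum_le R n n1); rewrite le_eqVlt; apply/orP; left; apply/eqP.
by apply: eq_bigr => k _; rewrite mulrA.
Qed.

Lemma kl_mgf (f : X -> R) : measurable_fun setT f -> (forall z, 0 <= f z <= 1) ->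
  (\int[mun]_x expeR (n%:R%:E * klb (n%:R^-1 * (\sum_(i < n) f (tnth x i)))
      (fine (\int[mu]_z (f z)%:E))) <= (2 * Num.sqrt n%:R)%:E)%E.
Proof.
move=> mf f01; have /andP[L0 L1] := mean01_itv _ _ _ mu _ mf f01.
have s1 : (1 <= (2 * Num.sqrt n%:R : R)%:E)%E.
  rewrite lee_fin; apply: (@le_trans _ _ (Num.sqrt n%:R)).
    by rewrite -[X in X <= _]sqrtr1 ler_wsqrtr// ler1n ltnW.
  by rewrite ler_peMl ?sqrtr_ge0 ?ler1n.
set L := fine _ in L0 L1 *.
have [LE0|Ln0] := eqVneq L 0.
  by rewrite LE0; apply: le_trans s1; exact: kl_mgf_0.
have [LE1|Ln1] := eqVneq L 1; last first.
  by apply: kl_mgf_oo => //; rewrite lt0r Ln0 L0 lt_neqAle Ln1.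
(* The case [L = 1] is the case [L = 0] for [1 - f], by the symmetry of [klb]. *)
apply: le_trans s1; have n0 : n%:R != 0 :> R by rewrite pnatr_eq0 -lt0n ltnW.
under eq_integral => x _.
  rewrite -klb_sym (_ : 1 - n%:R^-1 * _ = n%:R^-1 * \sum_(i < n) (1 - f (tnth x i))).
    rewrite LE1 subrr; over.
  by rewrite sumrB sumr_const card_ord mulrBr mulVf.
apply: (@kl_mgf_0 (fun z => 1 - f z)).
- exact: measurable_funB.
- by move=> z; rewrite subr_ge0 lerBlDr lerDl andbC.
- by rewrite mean01_integralC// -/L LE1 subrr.
Qed.
End klmgf.

(** * Exponential moments of squared functions with bounded differences *)

Section bounded_mean.
Context {d} {T : measurableType d} {R : realType} (P : probability T R).

(** Nonnegativity is kept next to boundedness so that real-valued means can be added and scaled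
    through the nonnegative integral, without integrability conditions. In return, inequalities
    between means have to be written without subtraction. *)
Definition bmeas (F : T -> R) :=
  measurable_fun setT F /\ exists M, forall x, 0 <= F x <= M.

Definition mean (F : T -> R) : R := fine (\int[P]_x (F x)%:E)%E.

Lemma meanE F : bmeas F -> (\int[P]_x (F x)%:E)%E = (mean F)%:E.
Proof.
move=> [mF [M FM]]; rewrite fineK// ge0_fin_numE; last first.
  by apply: integral_ge0 => x _; rewrite lee_fin; have /andP[] := FM x.
apply: (@le_lt_trans _ _ (\int[P]_x M%:E)%E); last by rewrite integral_prob_cst ltry.
apply: ge0_le_integral => //.
- by move=> x _; rewrite lee_fin; have /andP[] := FM x.
- exact/measurable_EFinP.
- by move=> x _; rewrite lee_fin; have /andP[] := FM x.
Qed.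

Lemma bmeas_ge0 F x : bmeas F -> 0 <= F x.
Proof. by move=> [_ [M /(_ x)/andP[]]]. Qed.

Lemma bmeasD F G : bmeas F -> bmeas G -> bmeas (fun x => F x + G x).
Proof.
move=> [mF [M FM]] [mG [N GN]]; split; first exact: measurable_funD.
exists (M + N) => x; have /andP[? ?] := FM x; have /andP[? ?] := GN x.
by rewrite addr_ge0//= lerD.
Qed.

Lemma bmeasM F G : bmeas F -> bmeas G -> bmeas (fun x => F x * G x).
Proof.
move=> [mF [M FM]] [mG [N GN]]; split; first exact: measurable_funM.
exists (M * N) => x; have /andP[? ?] := FM x; have /andP[? ?] := GN x.
by rewrite mulr_ge0//= ler_pM.
Qed.

Lemma bmeas_cst (k : R) : 0 <= k -> bmeas (fun=> k).
Proof. by move=> k0; split => //; exists k => _; rewrite k0 lexx. Qed.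

Lemma mean_cst k : mean (fun=> k) = k.
Proof. by rewrite /mean integral_prob_cst. Qed.

Lemma mean_ge0 F : bmeas F -> 0 <= mean F.
Proof.
move=> bF; rewrite fine_ge0// integral_ge0// => x _; rewrite lee_fin.
exact: bmeas_ge0.
Qed.

Lemma meanD F G : bmeas F -> bmeas G ->
  mean (fun x => F x + G x) = mean F + mean G.
Proof.
move=> bF bG; apply: EFin_inj; rewrite EFinD -!meanE//; last exact: bmeasD.
under eq_integral do rewrite EFinD.
rewrite ge0_integralD//.
- by move=> x _; rewrite lee_fin bmeas_ge0.
- by apply/measurable_EFinP; case: bF.
- by move=> x _; rewrite lee_fin bmeas_ge0.
- by apply/measurable_EFinP; case: bG.
Qed.

Lemma meanZ k F : 0 <= k -> bmeas F -> mean (fun x => k * F x) = k * mean F.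
Proof.
move=> k0 bF; apply: EFin_inj; rewrite EFinM -!meanE//; last first.
  by apply: (bmeasM (fun=> k)) => //; exact: bmeas_cst.
under eq_integral do rewrite EFinM.
rewrite ge0_integralZl//.
- by apply/measurable_EFinP; case: bF.
- by move=> x _; rewrite lee_fin bmeas_ge0.
Qed.

Lemma le_mean F G : bmeas F -> bmeas G -> (forall x, F x <= G x) -> mean F <= mean G.
Proof.
move=> bF bG FG; rewrite -lee_fin -!meanE//; apply: ge0_le_integral => //.
- by move=> x _; rewrite lee_fin bmeas_ge0.
- by apply/measurable_EFinP; case: bF.
- by apply/measurable_EFinP; case: bG.
- by move=> x _; rewrite lee_fin.
Qed.
End bounded_mean.

Lemma bmeas_comp d d' (T : measurableType d) (T' : measurableType d')
    (R : realType) (phi : T -> T') (F : T' -> R) :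
  measurable_fun setT phi -> bmeas F -> bmeas (fun x => F (phi x)).
Proof.
move=> mphi [mF [M FM]]; split; first exact: (measurableT_comp mF mphi).
by exists M => x.
Qed.

Lemma mean_law d d' (T : measurableType d) (T' : measurableType d')
    (R : realType) (P : probability T R) (P' : probability T' R)
    (phi : T -> T') (F : T' -> R) :
  measurable_fun setT phi ->
  (forall A, measurable A -> P (phi @^-1` A) = P' A) ->
  bmeas F -> mean P (fun x => F (phi x)) = mean P' F.
Proof.
move=> mphi PP' bF; rewrite /mean; congr fine.
apply: (@ge0_integral_law _ _ _ _ _ P P' phi (fun y => (F y)%:E)) => //.
- by apply/measurable_EFinP; case: bF.
- by move=> y; rewrite lee_fin bmeas_ge0.
Qed.

Lemma expR_diff_le (R : realType) (u v : R) : `|expR u - expR v| <= `|u - v| * (expR u + expR v).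
Proof.
wlog uv : u v / v <= u.
  move=> h; have [uv|/ltW uv] := leP v u; first exact: h.
  by rewrite distrC [`|u - v|]distrC [expR u + _]addrC; exact: h.
rewrite !ger0_norm ?subr_ge0 ?ler_expR//.
have : expR u * (1 + (v - u)) <= expR v.
  by rewrite -[in leRHS](subrKC u v) expRD ler_pM2l ?expR_gt0// expR_ge1Dx.
have := mulr_ge0 (_ : 0 <= u - v) (expR_ge0 v); rewrite subr_ge0 => /(_ uv).
by nra.
Qed.

Section concentration.
Context d (X : measurableType d) (R : realType) (mu : probability X R).
Variables (n : nat) (mun : probability (n.-tuple X) R).
Hypothesis hmun : forall B : 'I_n -> set X, (forall i, measurable (B i)) ->
     mun [set x | forall i, B i (tnth x i)] = (\prod_(i < n) mu (B i))%E.

Definition mix (J : pred 'I_n) (x y : n.-tuple X) : n.-tuple X :=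
  [tuple if J i then tnth y i else tnth x i | i < n].

Definition swapc (J : pred 'I_n) (p : n.-tuple X * n.-tuple X) :=
  (mix J p.1 p.2, mix J p.2 p.1).

Lemma measurable_mix J : measurable_fun setT
  (fun p : n.-tuple X * n.-tuple X => mix J p.1 p.2).
Proof.
apply/measurable_fun_tnthP => i.
rewrite (_ : _ \o _ = if J i then (fun p => tnth p.2 i) else (fun p => tnth p.1 i)).
  by case: (J i); apply: (measurableT_comp (measurable_tnth i)).
by apply/funext => p /=; rewrite tnth_mktuple; case: (J i).
Qed.

Lemma measurable_swapc J : measurable_fun setT (swapc J).
Proof.
apply: measurable_fun_pair => /=; first exact: measurable_mix.
have ms : measurable_fun setT (fun p : n.-tuple X * n.-tuple X => (p.2, p.1)).
  exact: measurable_fun_pair.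
exact: (measurableT_comp (measurable_mix J) ms).
Qed.

Let m2 : probability _ R := (mun \x mun)%E.

Lemma m2_box B C : (forall i, measurable (B i)) -> (forall i, measurable (C i)) ->
  m2 ([set x | forall i, B i (tnth x i)] `*` [set x | forall i, C i (tnth x i)]) =
  (\prod_(i < n) (mu (B i) * mu (C i)))%E.
Proof.
move=> mB mC; rewrite big_split/= -!hmun//; apply: product_measure1E; exact: measurable_box.
Qed.

(** On boxes, exchanging the [i]-th coordinates only permutes the two factors of
    [mu (B i) * mu (C i)]. *)
Lemma swapc_law J A : measurable A -> m2 (swapc J @^-1` A) = m2 A.
Proof.
move=> mA; have ms := measurable_swapc J.
apply: (@tuple2_prob_unique _ _ _ _ (pushforward m2 (swapc J)) m2) => //.
  suff : (m2 setT < +oo)%E by [].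
  by rewrite (probability_setT m2) ltry.
move=> B C mB mC; apply: etrans (esym (m2_box B C mB mC)).
pose B' i := if J i then C i else B i.
pose C' i := if J i then B i else C i.
have mB' i : measurable (B' i) by rewrite /B'; case: ifP.
have mC' i : measurable (C' i) by rewrite /C'; case: ifP.
transitivity (\prod_(i < n) (mu (B' i) * mu (C' i)))%E; last first.
  by apply: eq_bigr => i _; rewrite /B' /C'; case: ifP => // _; rewrite muleC.
rewrite -m2_box//; apply: (congr1 m2); apply/seteqP; split=> -[x y] /= [h1 h2].
  split=> i; have := h1 i; have := h2 i; rewrite /B' /C' !tnth_mktuple;
  by case: ifP.
by split=> i; have := h1 i; have := h2 i; rewrite /B' /C' !tnth_mktuple; case: ifP.
Qed.

Lemma mean_swapc J (F : n.-tuple X * n.-tuple X -> R) : bmeas F ->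
  mean m2 (fun p => F (swapc J p)) = mean m2 F.
Proof. by apply: mean_law; [exact: measurable_swapc|exact: swapc_law]. Qed.

Lemma mean_fst (F : n.-tuple X -> R) : bmeas F ->
  mean m2 (fun p => F p.1) = mean mun F.
Proof.
apply: mean_law => //= A mA.
rewrite (_ : fst @^-1` A = A `*` setT); last first.
  by apply/seteqP; split=> x /=; [|case].
apply: etrans (product_measure1E _ _ _ _) _ => //.
by rewrite -[RHS]mule1; congr (_ * _)%E; exact: probability_setT.
Qed.

Lemma mean_mix J (F : n.-tuple X -> R) : bmeas F ->
  mean m2 (fun p => F (mix J p.1 p.2)) = mean mun F.
Proof.
move=> bF; rewrite -mean_fst//; apply: (mean_swapc J (fun p => F p.1)).
by apply: bmeas_comp.
Qed.

Lemma mean_indep (F G : n.-tuple X -> R) : bmeas F -> bmeas G ->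
  mean m2 (fun p => F p.2 * G p.1) = mean mun F * mean mun G.
Proof.
move=> bF bG; apply: EFin_inj.
have bFG : bmeas (fun p : n.-tuple X * n.-tuple X => F p.2 * G p.1).
  by apply: bmeasM; apply: bmeas_comp.
rewrite -meanE// fubini_tonelli1; last 2 first.
- by apply/measurable_EFinP; case: bFG.
- by move=> p; rewrite lee_fin; exact: (bmeas_ge0 _ p bFG).
rewrite /fubini_F/=.
under eq_integral => x _.
  rewrite (eq_integral (fun y => (G x)%:E * (F y)%:E)%E); last first.
    by move=> y _; rewrite -EFinM mulrC.
  rewrite ge0_integralZl//; last 3 first.
  - by apply/measurable_EFinP; case: bF.
  - by move=> y _; rewrite lee_fin bmeas_ge0.
  - by rewrite lee_fin bmeas_ge0.
  rewrite meanE// muleC; over.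
rewrite ge0_integralZl//; last 3 first.
- by apply/measurable_EFinP; case: bG.
- by move=> y _; rewrite lee_fin bmeas_ge0.
- by rewrite lee_fin mean_ge0.
by rewrite meanE// EFinM.
Qed.

Variables (f : n.-tuple X -> R) (c : R).
Hypothesis mf : measurable_fun setT f.
Hypothesis f0 : forall x, 0 <= f x.
Hypothesis fM : exists M, forall x, f x <= M.
Hypothesis fc : forall k y x, `|f (replace_at k y x) - f x| <= c.

Let Z x := f x ^+ 2.
Let w (l : R) x := expR (l * Z x).

Lemma bmeas_sqr : bmeas Z.
Proof.
split; first exact: measurable_funX.
have [M hM] := fM; exists (M ^+ 2) => x.
by rewrite sqr_ge0/= lerXn2r// nnegrE// (le_trans (f0 x)).
Qed.

Lemma bmeas_exp_sqr l : 0 <= l -> bmeas (w l).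
Proof.
move=> l0; have [mZ [M ZM]] := bmeas_sqr; split.
  apply: measurableT_comp; first exact: measurable_expR.
  exact: measurable_funM.
exists (expR (l * M)) => x; rewrite expR_ge0/= ler_expR ler_wpM2l//.
by have /andP[] := ZM x.
Qed.

Let bH l : 0 <= l -> bmeas (fun x => Z x * w l x).
Proof. by move=> l0; apply: bmeasM; [exact: bmeas_sqr|exact: bmeas_exp_sqr]. Qed.

(** Here [p], [q] are the values of [f] at the sample before and after one exchange, and [r], [s]
    those at two successive hybrids. The claim bounds [(r^2 - s^2) (e^(l p^2) - e^(l q^2))]: the
    differences are at most [c (r + s)] and [l c (p + q)] times the sum of the exponentials,
    [(p + q) (r + s)] is at most the sum of the four squares, and monotonicity of [exp] removes the
    mixed products. Each function on the last lines will have mean [H l]; the weights 4 + 4 + 2 + 2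
    = 12, halved by symmetrization, are the origin of the 6 in [cov_le]. *)
Lemma pointwise_cov_le (l p q r s : R) : 0 <= l -> 0 <= p -> 0 <= q -> 0 <= r -> 0 <= s ->
  `|p - q| <= c -> `|r - s| <= c ->
  r ^+ 2 * expR (l * p ^+ 2) + s ^+ 2 * expR (l * q ^+ 2) <=
  s ^+ 2 * expR (l * p ^+ 2) + r ^+ 2 * expR (l * q ^+ 2) + l * c ^+ 2 *
   (4 * (p ^+ 2 * expR (l * p ^+ 2)) + 4 * (q ^+ 2 * expR (l * q ^+ 2)) +
    2 * (r ^+ 2 * expR (l * r ^+ 2)) + 2 * (s ^+ 2 * expR (l * s ^+ 2))).
Proof.
move=> l0 p0 q0 r0 s0 pq rs.
set P := p ^+ 2; set Q := q ^+ 2; set U := r ^+ 2; set S := s ^+ 2.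
have c0 : 0 <= c by exact: le_trans pq.
have P0 : 0 <= P by exact: sqr_ge0.
have Q0 : 0 <= Q by exact: sqr_ge0.
have U0 : 0 <= U by exact: sqr_ge0.
have S0 : 0 <= S by exact: sqr_ge0.
have mono (x y : R) : 0 <= (x - y) * (expR (l * x) - expR (l * y)).
  have [xy|/ltW xy] := leP y x.
    by rewrite mulr_ge0 ?subr_ge0 ?ler_expR ?ler_wpM2l.
  by rewrite mulr_le0 ?subr_le0 ?ler_expR ?ler_wpM2l.
have cross (x y : R) : 0 <= x -> 0 <= y ->
    x * expR (l * y) <= x * expR (l * x) + y * expR (l * y).
  move=> x0 y0; have := mono x y; have := mulr_ge0 y0 (expR_ge0 (l * x)); nra.
have h1 : `|U - S| <= c * (r + s).
  rewrite /U /S subr_sqr normrM ler_pM// ger0_norm ?addr_ge0//.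
have h2 : `|expR (l * P) - expR (l * Q)| <= l * (c * (p + q)) * (expR (l * P) + expR (l * Q)).
  apply: le_trans (expR_diff_le _ _ _) _; rewrite ler_wpM2r ?addr_ge0 ?expR_ge0//.
  rewrite -mulrBr normrM (ger0_norm l0) ler_wpM2l//.
  by rewrite /P /Q subr_sqr normrM ler_pM// ger0_norm ?addr_ge0.
have h3 : (U - S) * (expR (l * P) - expR (l * Q)) <=
   l * c ^+ 2 * ((P + Q + U + S) * (expR (l * P) + expR (l * Q))).
  apply: le_trans (ler_norm _) _; rewrite normrM.
  apply: le_trans (ler_pM _ _ h1 h2) _ => //.
  have -> : c * (r + s) * (l * (c * (p + q)) * (expR (l * P) + expR (l * Q))) =
    l * c ^+ 2 * ((p + q) * (r + s) * (expR (l * P) + expR (l * Q))) by ring.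
  rewrite ler_wpM2l ?mulr_ge0 ?sqr_ge0// ler_wpM2r ?addr_ge0 ?expR_ge0//.
  have := sqr_ge0 (p + q - (r + s)); have := sqr_ge0 (p - q); have := sqr_ge0 (r - s).
  rewrite /P /Q /U /S; nra.
have h4 : (P + Q + U + S) * (expR (l * P) + expR (l * Q)) <=
    4 * (P * expR (l * P)) + 4 * (Q * expR (l * Q)) +
    2 * (U * expR (l * U)) + 2 * (S * expR (l * S)).
  have := mono P Q; have := cross U P U0 P0; have := cross U Q U0 Q0.
  have := cross S P S0 P0; have := cross S Q S0 Q0.
  rewrite !mulrDl !mulrDr; nra.
have h5 := ler_wpM2l (mulr_ge0 l0 (sqr_ge0 c)) h4.
have := le_trans h3 h5; rewrite !mulrBl !mulrBr; lra.
Qed.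

Let V := mean mun Z.
(** [G] is the moment generating function of [Z], and [H] below is formally its derivative. *)
Let G l := mean mun (w l).
Let H l := mean mun (fun x => Z x * w l x).
Let Xk (k : nat) (p : n.-tuple X * n.-tuple X) := mix (fun i => (i < k)%N) p.1 p.2.

(* [Xk k] takes its first [k] coordinates from the independent copy; exchanging
   the [k]-th coordinates of the two copies maps [Xk k] to [Xk k.+1] and back, so
   both sides can be symmetrized and compared pointwise. *)
Lemma hybrid_step (l : R) (k : nat) : 0 <= l -> (k < n)%N ->
  mean m2 (fun p => Z (Xk k p) * w l p.1) <=
  mean m2 (fun p => Z (Xk k.+1 p) * w l p.1) + 6 * l * c ^+ 2 * H l.
Proof.
move=> l0 kn; pose kk := Ordinal kn; pose J := pred1 kk.
have bXk j (F : n.-tuple X -> R) : bmeas F -> bmeas (fun p => F (Xk j p)).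
  by move=> bF; apply: bmeas_comp => //; exact: measurable_mix.
have bJ (F : n.-tuple X -> R) : bmeas F -> bmeas (fun p => F (mix J p.1 p.2)).
  by move=> bF; apply: bmeas_comp => //; exact: measurable_mix.
have b1 (F : n.-tuple X -> R) : bmeas F ->
    bmeas (fun p : n.-tuple X * n.-tuple X => F p.1).
  by move=> bF; apply: bmeas_comp.
have bZ := bmeas_sqr; have bw := bmeas_exp_sqr l l0.
have Xk_swap p : Xk k (swapc J p) = Xk k.+1 p.
  apply: eq_from_tnth => i; rewrite !tnth_mktuple ltnS /J/=.
  rewrite -(val_eqE i kk)/=.
  by case: ltngtP.
have XkS_swap p : Xk k.+1 (swapc J p) = Xk k p.
  apply: eq_from_tnth => i; rewrite !tnth_mktuple ltnS /J/=.
  rewrite -(val_eqE i kk)/=.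
  by case: ltngtP.
have bF j : bmeas (fun p => Z (Xk j p) * w l p.1).
  by apply: bmeasM; [exact: bXk|exact: b1].
have bFJ j : bmeas (fun p => Z (Xk j p) * w l (mix J p.1 p.2)).
  by apply: bmeasM; [exact: bXk|exact: bJ].
have e1 : mean m2 (fun p => Z (Xk k.+1 p) * w l (mix J p.1 p.2)) =
    mean m2 (fun p => Z (Xk k p) * w l p.1).
  rewrite -(mean_swapc J _ (bF k)); congr mean; apply/funext => p.
  by rewrite Xk_swap.
have e2 : mean m2 (fun p => Z (Xk k p) * w l (mix J p.1 p.2)) =
    mean m2 (fun p => Z (Xk k.+1 p) * w l p.1).
  rewrite -(mean_swapc J _ (bF k.+1)); congr mean; apply/funext => p.
  by rewrite XkS_swap.
pose phi x := Z x * w l x.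
have bphi : bmeas phi by exact: bH.
have K0 : 0 <= l * c ^+ 2 by rewrite mulr_ge0// sqr_ge0.
have bZl (a : R) F : 0 <= a -> bmeas F ->
    bmeas (fun p : n.-tuple X * n.-tuple X => a * F p).
  by move=> a0 bF'; exact: (bmeasM _ _ (bmeas_cst _ a0) bF').
have bP1 := bZl 4 _ (ler0n _ 4) (b1 _ bphi).
have bP2 := bZl 4 _ (ler0n _ 4) (bJ _ bphi).
have bP3 := bZl 2 _ (ler0n _ 2) (bXk k _ bphi).
have bP4 := bZl 2 _ (ler0n _ 2) (bXk k.+1 _ bphi).
have bP12 := bmeasD _ _ bP1 bP2.
have bP123 := bmeasD _ _ bP12 bP3.
have bP := bmeasD _ _ bP123 bP4.
have bKP := bZl _ _ K0 bP.
have bR0 := bmeasD _ _ (bF k.+1) (bFJ k).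
have bR := bmeasD _ _ bR0 bKP.
have bL := bmeasD _ _ (bF k) (bFJ k.+1).
have : mean m2 (fun p => Z (Xk k p) * w l p.1 + Z (Xk k.+1 p) * w l (mix J p.1 p.2)) <=
    mean m2 (fun p => Z (Xk k.+1 p) * w l p.1 + Z (Xk k p) * w l (mix J p.1 p.2) +
      l * c ^+ 2 * (4 * phi p.1 + 4 * phi (mix J p.1 p.2) + 2 * phi (Xk k p) +
        2 * phi (Xk k.+1 p))).
  apply: le_mean; [exact: bL|exact: bR|move=> p].
  apply: pointwise_cov_le; [exact: l0|exact: f0|exact: f0|exact: f0|exact: f0| |].
    rewrite distrC; have -> : mix J p.1 p.2 = replace_at kk (tnth p.2 kk) p.1.
      by apply: eq_from_tnth => i; rewrite !tnth_mktuple /J/=; case: eqP => // ->.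
    exact: fc.
  rewrite distrC; have -> : Xk k.+1 p = replace_at kk (tnth p.2 kk) (Xk k p).
    apply: eq_from_tnth => i; rewrite !tnth_mktuple ltnS -(val_eqE i kk)/=.
    by case: ltngtP => // ik; congr (tnth _ _); exact: val_inj.
  exact: fc.
rewrite (meanD _ _ _ (bF k) (bFJ k.+1)) e1 (meanD _ _ _ bR0 bKP).
rewrite (meanD _ _ _ (bF k.+1) (bFJ k)) e2 (meanZ _ _ _ K0 bP).
rewrite (meanD _ _ _ bP123 bP4) (meanD _ _ _ bP12 bP3) (meanD _ _ _ bP1 bP2).
rewrite (meanZ _ _ _ (ler0n _ 4) (b1 _ bphi)) (meanZ _ _ _ (ler0n _ 4) (bJ _ bphi)).
rewrite (meanZ _ _ _ (ler0n _ 2) (bXk k _ bphi)).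
rewrite (meanZ _ _ _ (ler0n _ 2) (bXk k.+1 _ bphi)).
rewrite (mean_fst phi bphi) !(mean_mix _ phi bphi) -/(H l).
move: (mean m2 _) (mean m2 _) (H l) (c ^+ 2) => u v y z; lra.
Qed.

(** [Xk 0] is the sample itself, which gives [H l], and [Xk n] is the independent copy, for which
    the mean factors into [V * G l]; [n] applications of [hybrid_step] connect the two. *)
Lemma cov_le (l : R) : 0 <= l -> H l <= V * G l + n%:R * (6 * l * c ^+ 2) * H l.
Proof.
move=> l0.
have bZ := bmeas_sqr; have bw := bmeas_exp_sqr l l0.
have h k : (k <= n)%N -> H l <=
    mean m2 (fun p => Z (Xk k p) * w l p.1) + k%:R * (6 * l * c ^+ 2) * H l.
  elim: k => [_|k IH kn].
    rewrite !mul0r addr0 [leLHS]/H -(mean_fst (fun x => Z x * w l x)); last exact: bH.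
    rewrite le_eqVlt; apply/orP; left; apply/eqP; congr mean; apply/funext => p.
    congr (Z _ * _); apply: eq_from_tnth => i; by rewrite tnth_mktuple.
  have := IH (ltnW kn); have := hybrid_step l k l0 kn; rewrite -natr1; lra.
have := h n (leqnn n); congr (_ <= _ + _).
rewrite -mean_indep//; congr mean; apply/funext => p.
congr (Z _ * _); apply: eq_from_tnth => i; by rewrite tnth_mktuple ltn_ord.
Qed.

(* Discrete Gronwall: [cov_le] gives [H l <= 2 V (G l)] for [l <= lam], so over a
   short step [h] the function [G] grows at most by the factor [exp (6 V h)]. *)
Lemma sqr_mgf_le (lam : R) : 0 <= lam -> 12 * n%:R * c ^+ 2 * lam <= 1 ->
  G lam <= expR (6 * lam * V).
Proof.
move=> lam0 hlam.
have bZ := bmeas_sqr; have V0 : 0 <= V by exact: mean_ge0.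
have G0 l : 0 <= l -> 0 <= G l by move=> l0; apply/mean_ge0/bmeas_exp_sqr.
have H0 l : 0 <= l -> 0 <= H l by move=> l0; apply/mean_ge0/bH.
(* The hypothesis on [lam] makes the coefficient of [H l] in [cov_le] at most 1/2, so that term is
   absorbed on the left. *)
have HG l : 0 <= l <= lam -> H l <= 2 * V * G l.
  move=> /andP[l0 ll]; have := cov_le l l0.
  have : n%:R * (6 * l * c ^+ 2) * H l <= 2^-1 * H l.
    rewrite ler_wpM2r ?H0//.
    have : 12 * n%:R * c ^+ 2 * l <= 12 * n%:R * c ^+ 2 * lam.
      by rewrite ler_wpM2l// mulr_ge0 ?sqr_ge0// mulr_ge0.
    lra.
  lra.
(* The tangent is taken at [l + h], which gives an implicit Euler step [G (l + h) * (1 - x) <= G l]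
   with [x = 2 V h]. For [x >= 0], [1 <= (1 + 3 x) (1 - x)] holds exactly when [x <= 2 / 3]; the 6
   is this 3 times 2. *)
have inc l h : 0 <= l -> 0 <= h -> l + h <= lam -> 2 * V * h <= 2 / 3 ->
    G (l + h) <= expR (6 * V * h) * G l.
  move=> l0 h0 lh hV.
  have lh0 : 0 <= l + h by exact: addr_ge0.
  have h1 : G (l + h) <= G l + h * H (l + h).
    rewrite -meanZ//; last exact: bH.
    rewrite -meanD; [|exact: bmeas_exp_sqr|]; last first.
      by apply: (bmeasM (fun=> h)); [exact: bmeas_cst|exact: bH].
    apply: le_mean; first exact: bmeas_exp_sqr.
      apply: bmeasD; first exact: bmeas_exp_sqr.
      by apply: (bmeasM (fun=> h)); [exact: bmeas_cst|exact: bH].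
    move=> x; rewrite /w.
    have -> : l * Z x = (l + h) * Z x + (- (h * Z x)) by ring.
    rewrite expRD; have := expR_ge1Dx (- (h * Z x)).
    move/(ler_wpM2l (expR_ge0 ((l + h) * Z x))); lra.
  have h2 : H (l + h) <= 2 * V * G (l + h) by apply: HG; rewrite lh0.
  have h3 : G (l + h) * (1 - 2 * V * h) <= G l.
    by have := ler_wpM2l h0 h2; lra.
  have x0 : 0 <= 2 * V * h by rewrite mulr_ge0// mulr_ge0.
  have h4 : 1 <= expR (6 * V * h) * (1 - 2 * V * h).
    have h5 : 1 + 6 * V * h <= expR (6 * V * h) by exact: expR_ge1Dx.
    have h6 : 0 <= 1 - 2 * V * h by lra.
    apply: le_trans (ler_wpM2r h6 h5); nra.
  have := ler_wpM2l (expR_ge0 (6 * V * h)) h3.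
  have := ler_wpM2l (G0 _ lh0) h4; lra.
(* Enough steps for [2 V (lam / N) <= 2 / 3]. *)
pose N := (Num.truncn (3 * V * lam)).+1.
have N0 : 0 < N%:R :> R by rewrite ltr0n.
have hN : 3 * V * lam <= N%:R by rewrite ltW// truncnS_gt.
pose h := lam / N%:R.
have hh : 0 <= h by rewrite divr_ge0// ltW.
have lamE : lam = N%:R * h by rewrite /h mulrC divfK// gt_eqF.
have hV : 2 * V * h <= 2 / 3.
  rewrite /h mulrA ler_pdivrMr//; lra.
have {}inc j : (j <= N)%N -> G (j%:R * h) <= expR (6 * V * (j%:R * h)).
  elim: j => [_|j IH jN].
    rewrite mul0r mulr0 expR0 /G /w.
    by under eq_fun do rewrite mul0r expR0; rewrite mean_cst.
  rewrite -natr1 mulrDl mul1r; apply: le_trans (inc _ _ _ hh _ hV) _.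
  - by rewrite mulr_ge0.
  - by rewrite lamE -[X in _ + X]mul1r -mulrDl natr1 ler_wpM2r// ler_nat.
  by rewrite mulrDr expRD mulrC ler_wpM2r ?expR_ge0// IH// ltnW.
by have := inc N (leqnn N); rewrite -lamE mulrAC.
Qed.
End concentration.

(** * Sensitivity of vector-valued maps *)

Section enorm.
Context {R : realType} {m : nat}.
Implicit Types u v b : m.-tuple R.

Lemma cauchy_schwarz_sum (I : finType) (x y : I -> R) :
  (\sum_i x i * y i) ^+ 2 <= (\sum_i x i ^+ 2) * (\sum_i y i ^+ 2).
Proof.
set S := \sum_i x i ^+ 2; set T := \sum_i y i ^+ 2; set P := \sum_i x i * y i.
have T0 : 0 <= T by apply: sumr_ge0 => i _; exact: sqr_ge0.
have [T00|Tn0] := eqVneq T 0.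
  have y0 i : y i = 0.
    move/eqP: T00; rewrite psumr_eq0; last by move=> j _; exact: sqr_ge0.
    by move=> /allP/(_ i); rewrite mem_index_enum sqrf_eq0 => /(_ isT)/eqP.
  by rewrite T00 mulr0 /P big1 ?expr0n// => i _; rewrite y0 mulr0.
have Tp : 0 < T by rewrite lt0r Tn0.
have : 0 <= \sum_i (T * x i - P * y i) ^+ 2 by apply: sumr_ge0 => i _; exact: sqr_ge0.
have E (a b : R) : \sum_i (a * x i - b * y i) ^+ 2 = a ^+ 2 * S - 2 * a * b * P + b ^+ 2 * T.
  rewrite /S /T /P !mulr_sumr -sumrB -big_split/=.
  by apply: eq_bigr => i _; ring.
rewrite E.
have -> : T ^+ 2 * S - 2 * T * P * P + P ^+ 2 * T = T * (S * T - P ^+ 2) by ring.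
by rewrite pmulr_rge0// subr_ge0.
Qed.

Lemma enorm_ge0 u : 0 <= enorm u.
Proof. exact: sqrtr_ge0. Qed.

Lemma enorm_sqr u : enorm u ^+ 2 = \sum_(i < m) tnth u i ^+ 2.
Proof. by rewrite sqr_sqrtr// sumr_ge0// => i _; exact: sqr_ge0. Qed.

Lemma enorm_tsub_le u v b :
  enorm (tsub u b) <= enorm (tsub v b) + enorm (tsub u v).
Proof.
rewrite -(@ler_pXn2r _ 2)// ?nnegrE ?addr_ge0 ?enorm_ge0//.
rewrite sqrrD !enorm_sqr.
set S := \sum_(i < m) _ ; set T := \sum_(i < m) _; set U := \sum_(i < m) _.
have -> : S = T + (\sum_(i < m) tnth (tsub v b) i * tnth (tsub u v) i) *+ 2 + U.
  rewrite /S /T /U -sumrMnl -!big_split/=; apply: eq_bigr => i _.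
  by rewrite !tnth_mktuple; ring.
rewrite lerD2r lerD2l lerMn2r/=.
apply: le_trans (ler_norm _) _; rewrite -(@ler_pXn2r _ 2)// ?nnegrE ?mulr_ge0 ?enorm_ge0//.
by rewrite real_normK ?num_real// exprMn !enorm_sqr cauchy_schwarz_sum.
Qed.

Lemma enorm_tsubC u v : enorm (tsub u v) = enorm (tsub v u).
Proof.
rewrite /enorm; congr Num.sqrt; apply: eq_bigr => i _.
by rewrite !tnth_mktuple -[_ - _]opprB sqrrN.
Qed.

Lemma enorm_tsub_dist u v b :
  `|enorm (tsub u b) - enorm (tsub v b)| <= enorm (tsub u v).
Proof.
have := enorm_tsub_le u v b; have := enorm_tsub_le v u b.
rewrite (enorm_tsubC v u) ler_norml; lra.
Qed.

Lemma measurable_enorm_tsub d (T : measurableType d) (F G : T -> m.-tuple R) :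
  measurable_fun setT F -> measurable_fun setT G ->
  measurable_fun setT (fun x => enorm (tsub (F x) (G x))).
Proof.
move=> /measurable_fun_tnthP mF /measurable_fun_tnthP mG.
have ms : measurable_fun [set: R] (@Num.sqrt R).
  by apply: continuous_measurable_fun; exact: sqrt_continuous.
apply: (measurableT_comp ms); apply: measurable_sum => i.
apply: measurable_funX.
rewrite (_ : (fun _ => _) = fun x => tnth (F x) i - tnth (G x) i).
  by apply: measurable_funB; [exact: mF|exact: mG].
by apply/funext => x; rewrite tnth_mktuple.
Qed.
End enorm.

Section sensitivity.
Context d (X : measurableType d) (R : realType) (n m : nat).
Variable A : n.-tuple X -> m.-tuple R.

Lemma replace_at_id (T : Type) (k : 'I_n) (x : n.-tuple T) :
  replace_at k (tnth x k) x = x.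
Proof. by apply: eq_from_tnth => i; rewrite tnth_mktuple; case: eqP => // ->. Qed.

(** With [n > 0] and a point of [X], the supremum is at least a norm, which excludes [-oo]; the
    finite bound [s] excludes [+oo]. *)
Lemma sens_coef_real (s : R) : (0 < n)%N ->
  ((12 * n)%:R%:E * (sens_coef A * sens_coef A) <= s%:E)%E ->
  exists2 c : R, 12 * n%:R * c ^+ 2 <= s & forall k y x,
    enorm (tsub (A (replace_at k y x)) (A x)) <= c.
Proof.
move=> n0 hs.
have le_sens k y x :
    ((enorm (tsub (A (replace_at k y x)) (A x)))%:E <= sens_coef A)%E.
  apply: le_trans (le_bigmax _ _ k) => /=.
  apply: ereal_sup_ubound; exists x, y, (tnth x k).
  by rewrite replace_at_id.
have s0 : (0 <= sens_coef A)%E.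
  apply: le_trans (le_sens (Ordinal n0) point point).
  by rewrite lee_fin enorm_ge0.
move: hs le_sens s0; case: (sens_coef A) => [c|//|//].
  rewrite -!EFinM lee_fin natrM => hs le_sens _; exists c; first by rewrite expr2.
  by move=> k y x; rewrite -lee_fin.
by rewrite mulyy gt0_muley ?leye_eq// lte_fin ltr0n muln_gt0.
Qed.

(** Every tuple is reached from a constant one by [n] replacements. The bound makes the exponential
    moments finite from the outset. *)
Lemma bounded_diff_bounded (f : n.-tuple X -> R) (c : R) :
  (forall k y x, `|f (replace_at k y x) - f x| <= c) ->
  exists M, forall x, f x <= M.
Proof.
move=> fc; pose x0 : n.-tuple X := [tuple point | i < n].
exists (f x0 + n%:R * c) => x.
pose xk k : n.-tuple X := [tuple if (i < k)%N then tnth x i else point | i < n].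
suff h k : (k <= n)%N -> f (xk k) <= f x0 + k%:R * c.
  have := h n (leqnn n); congr (f _ <= _).
  by apply: eq_from_tnth => i; rewrite tnth_mktuple ltn_ord.
elim: k => [_|k IH kn].
  by rewrite mul0r addr0.
pose kk := Ordinal kn.
have -> : xk k.+1 = replace_at kk (tnth x kk) (xk k).
  apply: eq_from_tnth => i; rewrite !tnth_mktuple ltnS -(val_eqE i kk)/=.
  by case: ltngtP => // ik; congr (tnth _ _); exact: val_inj.
have := IH (ltnW kn); have := fc kk (tnth x kk) (xk k).
rewrite ler_norml -natr1 => /andP[_ ? ?]; lra.
Qed.
End sensitivity.

(** By the reverse triangle inequality the distance from [A x] to a fixed [b] inherits the bounded
    differences of [A], so the vector case reduces to [sqr_mgf_le] at [lam = 1 / s]. *)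
Lemma enorm_sqr_mgf_le d (X : measurableType d) (R : realType)
    (mu : probability X R) (n m : nat) (mun : probability (n.-tuple X) R)
    (hmun : forall B : 'I_n -> set X, (forall i, measurable (B i)) ->
     mun [set x | forall i, B i (tnth x i)] = (\prod_(i < n) mu (B i))%E)
    (A : n.-tuple X -> m.-tuple R) (mA : measurable_fun setT A) (s : R) :
  (0 < n)%N -> 0 < s ->
  ((12 * n)%:R%:E * (sens_coef A * sens_coef A) <= s%:E)%E ->
  forall b, exists2 V : R,
    (\int[mun]_x (enorm (tsub (A x) b) ^+ 2)%:E)%E = V%:E &
    (\int[mun]_x (expR (enorm (tsub (A x) b) ^+ 2 / s))%:E <= (expR (6 / s * V))%:E)%E.
Proof.
move=> n0 s0 /(sens_coef_real _ _ _ _ _ _ _ n0)[c hc Ac] b.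
pose f x := enorm (tsub (A x) b).
have mf : measurable_fun setT f by apply: measurable_enorm_tsub => //.
have f0 x : 0 <= f x by exact: enorm_ge0.
have fc k y x : `|f (replace_at k y x) - f x| <= c.
  exact: le_trans (enorm_tsub_dist _ _ _) (Ac _ _ _).
have fM := bounded_diff_bounded _ _ _ _ _ _ fc.
have bZ := bmeas_sqr _ _ _ _ _ mf f0 fM.
exists (mean mun (fun x => f x ^+ 2)); first exact: meanE.
have s0' : 0 <= s^-1 by rewrite invr_ge0 ltW.
have bw := bmeas_exp_sqr _ _ _ _ _ mf f0 fM _ s0'.
under eq_integral do rewrite mulrC.
rewrite (meanE _ _ bw) lee_fin.
apply: (sqr_mgf_le _ _ _ _ _ _ hmun _ c mf f0 fM fc) => //.
by rewrite ler_pdivrMr// mul1r.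
Qed.

(** * Gaussian weights on tuples *)

Lemma lebesgue_measure_shift (R : realType) (t : R) (B : set R) : measurable B ->
  lebesgue_measure ((fun r : R => r - t) @^-1` B) = lebesgue_measure B.
Proof.
move=> mB; pose phi := (fun r => r - t) : measurableTypeR R -> measurableTypeR R.
have mphi : measurable_fun setT phi by apply: measurable_funB.
apply/esym.
apply: (@lebesgue_measure_unique R (pushforward lebesgue_measure phi)) => //=.
move=> _ [[a b]] _ <-; rewrite /pushforward.
rewrite (_ : phi @^-1` _ = `]a + t, b + t]%classic); last first.
  apply/seteqP; split=> r; rewrite /= /phi !in_itv/=; lra.
rewrite !lebesgue_measure_itv/= !lte_fin ltrD2r.
by case: ifP => // _; rewrite -!EFinB; congr (_%:E); ring.
Qed.

Section lebesgue_tuple.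
Context {R : realType} {m : nat} (pi : {measure set (m.-tuple R) -> \bar R}).
Hypothesis hpi : forall B : 'I_m -> set R, (forall i, measurable (B i)) ->
     pi [set h | forall i, B i (tnth h i)] = (\prod_(i < m) lebesgue_measure (B i))%E.

Let g (k : nat) : set R := `[- k%:R, k%:R]%classic.

Let mg k : measurable (g k). Proof. exact: measurable_itv. Qed.

Let ndg : nondecreasing_seq g.
Proof.
move=> j k jk; apply/subsetPset => r; rewrite /g/= !in_itv/= => /andP[h1 h2].
have jk' : j%:R <= k%:R :> R by rewrite ler_nat.
by apply/andP; split; lra.
Qed.

Let gT : \bigcup_k g k = setT.
Proof.
apply/seteqP; split=> // r _; exists (Num.truncn `|r|).+1 => //.
by rewrite /g/= in_itv/= -ler_norml ltW// truncnS_gt.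
Qed.

Let pi_g k : (pi [set h | forall i, g k (tnth h i)] < +oo)%E.
Proof.
rewrite (hpi (fun=> g k) (fun=> mg k)) (eq_bigr (fun=> (k%:R - - k%:R)%:E)); last first.
  move=> i _; rewrite lebesgue_measure_itv/= lte_fin; case: ifP => // /negbT.
  rewrite -leNgt => h; have k0 : k%:R = 0 :> R by have := ler0n R k; lra.
  by rewrite k0 oppr0 subrr.
by rewrite prodEFin ltry.
Qed.

Lemma lebesgue_tuple_sigma_finite : sigma_finite setT pi.
Proof.
exists (fun k => [set h | forall i, g k (tnth h i)]); last first.
  by move=> k; split => //; exact: (measurable_box _ _ _ (fun=> g k)).
apply/seteqP; split=> // x _.
have /choice[N hN] : forall i, exists k, g k (tnth x i).
  by move=> i; have : setT (tnth x i) by []; rewrite -gT => -[k _ ?]; exists k.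
exists (\max_i N i)%N => //= i.
have /subsetPset := ndg _ _ (leq_bigmax i : (N i <= \max_i N i)%N).
by apply; exact: hN.
Qed.

Lemma measurable_tsub (b : m.-tuple R) : measurable_fun setT (tsub ^~ b).
Proof.
apply/measurable_fun_tnthP => i.
rewrite (_ : _ \o _ = fun x => tnth x i - tnth b i).
  by apply: measurable_funB => //; exact: measurable_tnth.
by apply/funext => x /=; rewrite tnth_mktuple.
Qed.

Lemma lebesgue_tuple_shift (b : m.-tuple R) A : measurable A ->
  pi (tsub ^~ b @^-1` A) = pi A.
Proof.
move=> mA; have mt := measurable_tsub b.
apply/esym/(@tuple_measure_unique _ _ _ _ g mg ndg gT pi (pushforward pi (tsub ^~ b))) => //.
move=> B mB; rewrite hpi//.
have mB' i : measurable ((fun r => r - tnth b i) @^-1` B i).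
  rewrite -[X in measurable X]setTI.
  exact: (measurable_funB (@measurable_id _ _ setT) (measurable_cst (tnth b i))).
transitivity (pi [set h | forall i, ((fun r => r - tnth b i) @^-1` B i) (tnth h i)]).
  apply: etrans (esym (hpi _ mB')).
  by apply: eq_bigr => i _; rewrite lebesgue_measure_shift.
apply: (congr1 pi); apply/seteqP; split=> h /= hB i; have := hB i; by rewrite ?tnth_mktuple.
Qed.
End lebesgue_tuple.

Section gauss.
Context {R : realType} {m : nat} (pi : {sigma_finite_measure set (m.-tuple R) -> \bar R}).
Hypothesis hpi : forall B : 'I_m -> set R, (forall i, measurable (B i)) ->
     pi [set h | forall i, B i (tnth h i)] = (\prod_(i < m) lebesgue_measure (B i))%E.
Variables (sigma : R) (sigma0 : 0 < sigma).

(** The Gaussian density left unnormalized: by translation invariance its integral is the same for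
    all centres. *)
Definition gaussw (b h : m.-tuple R) : R :=
  expR (- enorm (tsub h b) ^+ 2 / (2 * sigma ^+ 2)).

Lemma measurable_gaussw d (T : measurableType d) (F G : T -> m.-tuple R) :
  measurable_fun setT F -> measurable_fun setT G ->
  measurable_fun setT (fun x => gaussw (F x) (G x)).
Proof.
move=> mF mG; apply: measurableT_comp; first exact: measurable_expR.
apply: measurable_funM => //; apply: measurable_funN.
by apply: measurable_funX; exact: measurable_enorm_tsub.
Qed.

Lemma measurable_gaussw1 b : measurable_fun setT (gaussw b).
Proof. by apply: measurable_gaussw => //; exact: measurable_id. Qed.

Lemma integral_gaussw_shift b b' :
  (\int[pi]_h (gaussw b h)%:E = \int[pi]_h (gaussw b' h)%:E)%E.
Proof.
pose z : m.-tuple R := [tuple 0 | i < m].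
have E a : (\int[pi]_h (gaussw a h)%:E = \int[pi]_h (gaussw z h)%:E)%E.
  rewrite -[RHS](@ge0_integral_law _ _ _ _ _ pi pi (tsub ^~ a)); last 4 first.
  - exact: measurable_tsub.
  - by move=> A mA; exact: lebesgue_tuple_shift.
  - by apply/measurable_EFinP; exact: measurable_gaussw1.
  - by move=> h; rewrite lee_fin expR_ge0.
  apply: eq_integral => h _; rewrite /gaussw (_ : tsub (tsub h a) z = tsub h a)//.
  by apply: eq_from_tnth => i; rewrite !tnth_mktuple subr0.
by rewrite !E.
Qed.

(** [c] is the reflection of [b] in [a], so the parallelogram law gives [|h - b|^2 + |h - c|^2 = 2
    |h - a|^2 + 2 |a - b|^2]. *)
Lemma gaussw_sqr a b c h : (forall i, tnth c i = 2 * tnth a i - tnth b i) ->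
  gaussw a h ^+ 2 = gaussw b h * gaussw c h * expR (enorm (tsub a b) ^+ 2 / sigma ^+ 2).
Proof.
move=> cE; rewrite /gaussw -expRM_natl -!expRD; congr expR.
rewrite !enorm_sqr.
have -> : \sum_(i < m) tnth (tsub h c) i ^+ 2 =
    2 * (\sum_(i < m) tnth (tsub h a) i ^+ 2) - \sum_(i < m) tnth (tsub h b) i ^+ 2
    + 2 * (\sum_(i < m) tnth (tsub a b) i ^+ 2).
  rewrite !mulr_sumr -sumrB -big_split/=; apply: eq_bigr => i _.
  by rewrite !tnth_mktuple cE; ring.
by field; rewrite gt_eqF.
Qed.

Variables (Q : probability (m.-tuple R) R) (b : m.-tuple R).
Hypothesis hQ : forall B, measurable B ->
  (Q B * \int[pi]_h (gaussw b h)%:E = \int[pi]_(h in B) (gaussw b h)%:E)%E.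

(* Finiteness needs no Gaussian integral: on a unit box the right-hand side of
   [hQ] lies in [(0, 1]], which rules out an infinite normalization. *)
Lemma gauss_norm : exists2 Z : R, 0 < Z & (\int[pi]_h (gaussw b h)%:E)%E = Z%:E.
Proof.
pose B : set (m.-tuple R) := [set h | forall i, `[0, 1]%classic (tnth h i)].
have mB : measurable B.
  by apply: (measurable_box _ _ _ (fun=> `[0, 1]%classic : set R)) => i.
have piB : pi B = 1%E.
  rewrite (hpi (fun=> `[0, 1]%classic : set R))// big1// => i _.
  by rewrite lebesgue_measure_itv/= lte_fin ltr01 oppr0 adde0.
have mq : measurable_fun setT (fun h => (gaussw b h)%:E).
  by apply/measurable_EFinP; exact: measurable_gaussw1.
have mqB : measurable_fun B (fun h => (gaussw b h)%:E) by exact: measurable_funTS.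
have q0 h : (0 <= (gaussw b h)%:E)%E by rewrite lee_fin expR_ge0.
have IB0 : (0 < \int[pi]_(h in B) (gaussw b h)%:E)%E.
  rewrite lt0e integral_ge0// andbT; apply/eqP => I0.
  have /(ae_eq_integral_abs pi mB mqB)[N [mN N0 hN]] :
      (\int[pi]_(h in B) `|(gaussw b h)%:E| = 0)%E.
    by rewrite -[RHS]I0; apply: eq_integral => h _; rewrite gee0_abs.
  have BN : B `<=` N.
    move=> h Bh; apply: hN => /= /(_ Bh) -[/eqP].
    by rewrite /gaussw gt_eqF// expR_gt0.
  have := le_measure pi _ _ BN; rewrite !inE => /(_ mB mN).
  rewrite [X in (_ <= X)%E](_ : _ = 0%E)//.
  by rewrite [X in (X <= _)%E](_ : _ = 1%E)// lee_fin ler10.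
have IB1 : (\int[pi]_(h in B) (gaussw b h)%:E <= 1)%E.
  apply: (@le_trans _ _ (\int[pi]_(h in B) 1%:E)%E).
    apply: ge0_le_integral => // h _; rewrite lee_fin -expR0 ler_expR.
    by rewrite mulNr oppr_le0 divr_ge0 ?sqr_ge0// mulr_ge0// sqr_ge0.
  by rewrite integral_cst// mul1e [X in (X <= _)%E](_ : _ = 1%E).
have I0 : (\int[pi]_(h in B) (gaussw b h)%:E <= \int[pi]_h (gaussw b h)%:E)%E.
  exact: ge0_subset_integral.
have := hQ B mB; move: I0 IB0 IB1.
case: (\int[pi]_h (gaussw b h)%:E)%E => [r||] I0 IB0 IB1 E.
- by exists r => //; rewrite -lte_fin (lt_le_trans IB0).
- exfalso; move: IB0 IB1; rewrite -E.
  have := measure_ge0 Q B; rewrite le_eqVlt => /orP[/eqP QB0|QB0].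
    by rewrite -[X in (X * _)%E]QB0 mul0e ltxx.
  by rewrite gt0_muley.
- by exfalso; have := lt_le_trans IB0 I0.
Qed.

(** By [hQ], integrating [gaussw b / Z] over any measurable set gives its [Q]-measure. Hence it
    agrees [pi]-almost everywhere with the Radon-Nikodym derivative, and integrals transfer by
    change of measure. *)
Lemma integral_gauss (f : m.-tuple R -> \bar R) Z : 0 < Z ->
  (\int[pi]_h (gaussw b h)%:E)%E = Z%:E ->
  measurable_fun setT f -> (forall h, 0 <= f h)%E ->
  (\int[Q]_h f h = (Z^-1)%:E * \int[pi]_h (f h * (gaussw b h)%:E))%E.
Proof.
move=> Z0 ZE mf f0.
have mq : measurable_fun setT (fun h => (gaussw b h)%:E).
  by apply/measurable_EFinP; exact: measurable_gaussw1.
have Zi0 : (0 <= (Z^-1)%:E)%E by rewrite lee_fin invr_ge0 ltW.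
have q0 h : (0 <= (gaussw b h)%:E)%E by rewrite lee_fin expR_ge0.
have QE B : measurable B -> Q B = (\int[pi]_(h in B) ((Z^-1)%:E * (gaussw b h)%:E))%E.
  move=> mB; rewrite ge0_integralZl//; last exact: measurable_funTS.
  rewrite -hQ// ZE muleCA -EFinM mulVf ?gt_eqF// mule1//.
have Qpi : Q `<< pi.
  move=> N nN B mB BN; have piB := nN B mB BN.
  have mZq := emeasurable_funM (measurable_cst (Z^-1)%:E) mq.
  have := integral_abs_eq0 mB (measurable_funTS mZq) piB.
  rewrite QE// => I0; rewrite -[RHS]I0; apply: eq_integral => h _.
  by rewrite gee0_abs// mule_ge0.
rewrite -(Radon_Nikodym_SigmaFinite.change_of_variables Qpi)//.
rewrite -ge0_integralZl//; last 2 first.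
- exact: emeasurable_funM.
- by move=> h _; rewrite mule_ge0.
have mRN := measurable_int _ (Radon_Nikodym_SigmaFinite.f_integrable Qpi).
apply: ae_eq_integral => //.
- exact: emeasurable_funM.
- by apply: emeasurable_funM => //; exact: emeasurable_funM.
have h : ae_eq pi setT (Radon_Nikodym_SigmaFinite.f Q pi)
    (fun h => (Z^-1)%:E * (gaussw b h)%:E)%E.
  apply: integral_ae_eq => //.
  - exact: Radon_Nikodym_SigmaFinite.f_integrable.
  - exact: emeasurable_funM.
  - by move=> B _ mB; rewrite -Radon_Nikodym_SigmaFinite.f_integral//; exact: QE.
apply: filterS h => h + _ => /(_ I) ->.
by rewrite muleCA.
Qed.
End gauss.

(** * Change of measure *)

(** Let [r] be the density of [P] with respect to [Q]. Where [r > 0] and [F] is finite,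
    [ln u <= u - 1] at [u = exp F / (r M)] reads [F <= ln r + ln M + u - 1], and the [P]-mean of [u]
    is at most 1 because [r] cancels under the change of measure. *)
Lemma donsker_varadhan d (T : measurableType d) (R : realType)
    (P Q : probability T R) (F : T -> \bar R) (M : R) :
  measurable_fun setT F -> (forall x, 0 <= F x)%E ->
  (\int[Q]_x expeR (F x) <= M%:E)%E ->
  (\int[P]_x F x <= KLdiv P Q + (ln M)%:E)%E.
Proof.
move=> mF F0 FM; rewrite /KLdiv; case: pselect => [PQ|nPQ]; last first.
  by rewrite addye// leey.
have PQ' : P `<< Q by exact: PQ.
have mE : measurable_fun setT (fun x => expeR (F x)) by exact: measurable_expeR_ge0.
(* [F >= 0] forces this, and then [ln M] can be integrated as a nonnegative constant. *)
have M1 : 1 <= M.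
  rewrite -lee_fin; apply: le_trans FM.
  rewrite -[leLHS](integral_prob_cst _ _ _ Q 1); apply: ge0_le_integral => //.
  by move=> x _; rewrite -expeR0 lee_expeR.
have M0 : 0 < M by exact: lt_le_trans M1.
pose f := Radon_Nikodym_SigmaFinite.f P Q.
have f0 x : (0 <= f x)%E by exact: Radon_Nikodym_SigmaFinite.f_ge0.
have ff x : f x \is a fin_num by exact: Radon_Nikodym_SigmaFinite.f_fin_num.
have mf : measurable_fun setT f.
  exact: measurable_int _ (Radon_Nikodym_SigmaFinite.f_integrable PQ').
have fE g : measurable_fun setT g -> (forall x, 0 <= g x)%E ->
    (\int[P]_x g x = \int[Q]_x (g x * f x))%E.
  by move=> mg g0; rewrite -(Radon_Nikodym_SigmaFinite.change_of_variables PQ').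
pose r x := fine (f x).
have r0 x : 0 <= r x by exact: fine_ge0.
have mr : measurable_fun setT r by exact: measurableT_comp.
have rE x : f x = (r x)%:E by rewrite fineK.
pose a x : \bar R := (ln (r x))%:E.
have ma : measurable_fun setT a.
  by apply/measurable_EFinP; exact: measurableT_comp.
(* [KLdiv] uses the derivative of [P] seen as a charge, the computation the sigma-finite version;
   they agree [Q]-almost everywhere, hence [P]-almost everywhere. *)
have -> : (\int[P]_x (ln (fine (Radon_Nikodym (charge_of_finite_measure P) Q x)))%:E =
    \int[P]_x a x)%E.
  apply: ae_eq_integral => //.
    apply/measurable_EFinP; apply: measurableT_comp => //.
    apply: measurableT_comp => //.
  have := ae_eq_Radon_Nikodym_SigmaFinite PQ' measurableT.
  move=> /(null_dominates_ae_eq measurableT PQ').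
  by apply: filterS => x + _ => /(_ I) <-.
(* [r * max (- ln r) 0 <= 1], since [- ln r <= 1 / r - 1]. So the KL integral is a meaningful
   difference even if its positive part is infinite. *)
have neg_fin : (\int[P]_x a^\- x \is a fin_num)%E.
  rewrite ge0_fin_numE; last by apply: integral_ge0.
  rewrite fE//; last exact: measurable_funeneg.
  apply: (@le_lt_trans _ _ (\int[Q]_x 1%:E)%E); last by rewrite integral_prob_cst ltry.
  apply: ge0_le_integral => //.
  - by move=> x _; rewrite mule_ge0.
  - by apply: emeasurable_funM => //; exact: measurable_funeneg.
  move=> x _; rewrite rE funenegE /a -EFinN -EFin_max -EFinM lee_fin.
  have := r0 x; rewrite le0r => /orP[/eqP->|rx]; first by rewrite mulr0.
  have [_|_] := leP (- ln (r x)) 0; first by rewrite mul0r.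
  rewrite -ler_pdivlMr// div1r -lnV ?posrE//.
  by apply: le_trans (ln_le_subr1 _ _) _; rewrite ?invr_gt0// lerBlDr lerDl.
(* [u] is the likelihood ratio [e^F / (r M)], set to [+oo] where [r = 0]; there
   [u * f = +oo * 0 = 0]. *)
pose u x : \bar R := if r x == 0 then +oo%E else ((r x * M)^-1%:E * expeR (F x))%E.
have mu : measurable_fun setT u.
  apply: measurable_fun_ifT => //; first exact: measurable_fun_eqr.
  apply: emeasurable_funM => //; apply/measurable_EFinP.
  rewrite (_ : (fun _ => _) = fun x => if r x == 0 then 0 else expR (- ln (r x * M))).
    apply: measurable_fun_ifT => //; first exact: measurable_fun_eqr.
    apply: measurableT_comp => //; apply: measurable_funN.
    by apply: measurableT_comp => //; exact: measurable_funM.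
  apply/funext => x; case: eqP => [->|/eqP rx]; first by rewrite mul0r invr0.
  by rewrite expRN lnK// posrE mulr_gt0// lt0r rx r0.
have u0 x : (0 <= u x)%E.
  rewrite /u; case: ifP => // _; rewrite mule_ge0 ?expeR_ge0// lee_fin.
  by rewrite invr_ge0 mulr_ge0// ltW.
have U1 : (\int[P]_x u x <= 1)%E.
  rewrite fE//; apply: (@le_trans _ _ (\int[Q]_x ((M^-1)%:E * expeR (F x)))%E).
    apply: ge0_le_integral => //.
    - by move=> x _; rewrite mule_ge0.
    - exact: emeasurable_funM.
    - exact: emeasurable_funM.
    move=> x _; rewrite rE /u; case: eqP => [->|/eqP rx].
      by rewrite mule0 mule_ge0 ?expeR_ge0// lee_fin invr_ge0 ltW.
    rewrite muleAC -EFinM invfM mulrAC mulVf// mul1r//.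
  rewrite ge0_integralZl//; last 2 first.
  - by move=> x _; exact: expeR_ge0.
  - by rewrite lee_fin invr_ge0 ltW.
  apply: (@le_trans _ _ ((M^-1)%:E * M%:E)%E).
    by apply: lee_wpmul2l => //; rewrite lee_fin invr_ge0 ltW.
  by rewrite -EFinM mulVf// gt_eqF.
have lnM0 : 0 <= ln M by rewrite ln_ge0.
(* The pointwise inequality is integrated with every negative term moved across, so that both sides
   are sums of nonnegative functions. *)
have key : (\int[P]_x F x + 1 + \int[P]_x a^\- x <=
    \int[P]_x a^\+ x + (ln M)%:E + \int[P]_x u x)%E.
  have man := measurable_funeneg ma; have map := measurable_funepos ma.
  rewrite -[X in (_ + X + _ <= _)%E](integral_prob_cst _ _ _ P 1).
  rewrite -[X in (_ <= _ + X + _)%E](integral_prob_cst _ _ _ P (ln M)).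
  rewrite -ge0_integralD//.
  rewrite -ge0_integralD//; last 2 first.
  - by move=> x _; rewrite adde_ge0.
  - exact: emeasurable_funD.
  rewrite -ge0_integralD//.
  rewrite -ge0_integralD//; last 2 first.
  - by move=> x _; rewrite adde_ge0.
  - exact: emeasurable_funD.
  apply: ge0_le_integral => //.
  - by move=> x _; rewrite !adde_ge0.
  - by apply: emeasurable_funD => //; exact: emeasurable_funD.
  - by apply: emeasurable_funD => //; exact: emeasurable_funD.
  move=> x _; rewrite /u funenegE funeposE /a -EFinN -!EFin_max.
  case: eqP => [_|/eqP rx]; first by rewrite addey// leey.
  have rp : 0 < r x by rewrite lt0r rx r0.
  have := F0 x; case: (F x) => [y _|_|//]; last first.
    by rewrite /= gt0_muley ?lte_fin ?invr_gt0 ?mulr_gt0// addey// leey.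
  rewrite /= -!EFinM -!EFinD lee_fin.
  have := ln_le_subr1 ((r x * M)^-1 * expR y).
  rewrite mulr_gt0 ?invr_gt0 ?mulr_gt0 ?expR_gt0// => /(_ isT).
  rewrite lnM ?posrE ?invr_gt0 ?mulr_gt0 ?expR_gt0// expRK lnV ?posrE ?mulr_gt0//.
  rewrite lnM ?posrE//.
  have [?|?] := leP (- ln (r x)) 0; have [?|?] := leP (ln (r x)) 0; lra.
rewrite /= [X in (_ <= X + _)%E]integralE; move: key U1 neg_fin.
have : (0 <= \int[P]_x F x)%E by exact: integral_ge0.
have : (0 <= \int[P]_x a^\+ x)%E by exact: integral_ge0.
have : (0 <= \int[P]_x u x)%E by exact: integral_ge0.
case: (\int[P]_x F x)%E => [IF||] //; case: (\int[P]_x a^\+ x)%E => [Ip||] //;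
  case: (\int[P]_x u x)%E => [Iu||] //; case: (\int[P]_x a^\- x)%E => [In||] //= _ _ _.
  by rewrite !lee_fin => ? ? _; lra.
by move=> *; rewrite leey.
Qed.

(** * Decoupling the Gibbs measure from the sample *)

(** Expand [(t * w * qa - qA)^2 >= 0] and divide by [2 t qa]; the constraint turns [qA^2 / (2 t qa)]
    into [e * qc / (2 t)]. [w] is extended because it will be an exponential of a possibly infinite
    relative entropy. *)
Lemma amgm_weighted (R : realType) (t qA qa qc e : R) (w : \bar R) :
  0 < t -> 0 < qA -> 0 < qa -> 0 < qc -> 0 < e -> (0 <= w)%E ->
  qA ^+ 2 = qa * qc * e ->
  (w * qA%:E <= (t / 2)%:E * (w * w * qa%:E) + (e / (2 * t))%:E * qc%:E)%E.
Proof.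
move=> t0 qA0 qa0 qc0 e0; case: w => [w|_ _|//]; last first.
  by rewrite !gt0_mulye ?lte_fin// gt0_muley ?lte_fin ?divr_gt0//.
rewrite -!EFinM -EFinD !lee_fin => w0 E.
have t20 : 0 < 2 * t by rewrite mulr_gt0.
rewrite -(ler_pM2l t20).
have -> : 2 * t * (t / 2 * (w * w * qa) + e / (2 * t) * qc) =
  t ^+ 2 * w ^+ 2 * qa + e * qc by field; rewrite gt_eqF.
rewrite -(ler_pM2l qa0).
have := sqr_ge0 (t * w * qa - qA); rewrite sqrrB E; lra.
Qed.

Section gibbs.
Context {R : realType} {dX : measure_display} {X : measurableType dX}
  (mu : probability X R) {n d : nat} (mun : probability (n.-tuple X) R).
Hypothesis hmun : forall B : 'I_n -> set X, (forall i, measurable (B i)) ->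
     mun [set x | forall i, B i (tnth x i)] = (\prod_(i < n) mu (B i))%E.
Variable pi : {sigma_finite_measure set (d.-tuple R) -> \bar R}.
Hypothesis hpi : forall B : 'I_d -> set R, (forall i, measurable (B i)) ->
     pi [set h | forall i, B i (tnth h i)] = (\prod_(i < d) lebesgue_measure (B i))%E.
Variable loss : d.-tuple R -> X -> R.
Hypothesis hloss_meas : measurable_fun [set: d.-tuple R * X] (fun p => loss p.1 p.2).
Hypothesis hloss01 : forall h z, 0 <= loss h z <= 1.
Variables (A : n.-tuple X -> d.-tuple R) (hA : measurable_fun setT A).
Variables (sigma : R) (hsigma : 0 < sigma).
Variable Q : n.-tuple X -> probability (d.-tuple R) R.
Hypothesis hQ : forall x B, measurable B ->
  (Q x B * \int[pi]_h (gaussw sigma (A x) h)%:E =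
   \int[pi]_(h in B) (gaussw sigma (A x) h)%:E)%E.
Hypothesis n1 : (1 < n)%N.

Let L h := true_risk mu loss h.
Let kl h (x : n.-tuple X) := klb (emp_risk loss h x) (L h).

Lemma measurable_loss h : measurable_fun setT (loss h).
Proof. exact: (measurable_fun_pair2 _ hloss_meas). Qed.

Lemma true_risk_itv h : 0 <= L h <= 1.
Proof. by apply: mean01_itv; [exact: measurable_loss|exact: hloss01]. Qed.

Lemma emp_risk_itv h (x : n.-tuple X) : 0 <= emp_risk loss h x <= 1.
Proof. by apply: emp_mean_itv. Qed.

Lemma kl_ge0 h x : (0 <= kl h x)%E.
Proof. by apply: klb_ge0; [exact: emp_risk_itv|exact: true_risk_itv]. Qed.

Lemma measurable_true_risk : measurable_fun setT L.
Proof.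
pose f (p : d.-tuple R * X) := (loss p.1 p.2)%:E.
have mf : measurable_fun setT f by apply/measurable_EFinP.
have f0 p : (0 <= f p)%E by rewrite lee_fin; have /andP[] := hloss01 p.1 p.2.
exact: (measurableT_comp _ (measurable_fun_fubini_tonelli_F (m2 := mu) f mf f0)).
Qed.

Lemma measurable_kl_pair :
  measurable_fun setT (fun p : n.-tuple X * d.-tuple R => kl p.2 p.1).
Proof.
apply: measurable_klb.
- by move=> p; exact: emp_risk_itv.
- by move=> p; exact: true_risk_itv.
- apply: measurable_funM => //; apply: measurable_sum => i.
  have mp : measurable_fun setT
      (fun p : n.-tuple X * d.-tuple R => (p.2, tnth p.1 i)).
    apply: measurable_fun_pair => //.
    by apply: (measurableT_comp (measurable_tnth i)).
  exact: (measurableT_comp hloss_meas mp).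
- exact: (measurableT_comp measurable_true_risk).
Qed.

Let wk (k : R) (p : n.-tuple X * d.-tuple R) := expeR (k%:E * kl p.2 p.1).

Lemma measurable_wk k : 0 <= k -> measurable_fun setT (wk k).
Proof.
move=> k0; apply: measurable_expeR_ge0.
  by apply: emeasurable_funM => //; exact: measurable_kl_pair.
by move=> p; rewrite mule_ge0// ?lee_fin// kl_ge0.
Qed.

Lemma wk_half p : (wk (n%:R / 2) p * wk (n%:R / 2) p = wk n%:R p)%E.
Proof.
rewrite /wk -expeRD -ge0_muleDl ?lee_fin ?divr_ge0//.
by congr (expeR (_%:E * _)); field.
Qed.

Variables (V : R) (b : d.-tuple R).
Hypothesis hV :
  (\int[mun]_x (expR (enorm (tsub (A x) b) ^+ 2 / sigma ^+ 2))%:E <=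
   (expR (6 / sigma ^+ 2 * V))%:E)%E.

Let S : R := 2 * Num.sqrt n%:R.
Let G : R := expR (6 / sigma ^+ 2 * V).

Let M x := (\int[Q x]_h wk (n%:R / 2) (x, h))%E.

(** [Q] is a bare family of probabilities, so measurability of [M] has to come from the Gaussian
    density and Tonelli over [pi]. It is bundled with the bound because both start from
    [M x = Z^-1 * J x]. *)
Lemma gibbs_mgf_meas_le : measurable_fun setT M /\
  (\int[mun]_x M x <= (Num.sqrt (S * G))%:E)%E.
Proof.
have S0 : 0 < S by rewrite mulr_gt0// sqrtr_gt0 ltr0n ltnW.
have G0 : 0 < G by exact: expR_gt0.
have n20 : 0 <= n%:R / 2 :> R by rewrite divr_ge0.
have [Z Z0 ZA] := gauss_norm pi hpi sigma (Q point) (A point) (hQ point).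
have ZE c : (\int[pi]_h (gaussw sigma c h)%:E)%E = Z%:E.
  by rewrite -ZA; exact: integral_gaussw_shift.
have Zi0 : 0 <= Z^-1 by rewrite invr_ge0 ltW.
have q0 c h : 0 < gaussw sigma c h by exact: expR_gt0.
have q0e c h : (0 <= (gaussw sigma c h)%:E)%E by rewrite lee_fin ltW.
have w0 k p : (0 <= wk k p)%E by exact: expeR_ge0.
have mw := measurable_wk _ n20.
have mwn := measurable_wk n%:R (ler0n _ _).
have mqA : measurable_fun setT
    (fun p : n.-tuple X * d.-tuple R => (gaussw sigma (A p.1) p.2)%:E).
  by apply/measurable_EFinP; apply: measurable_gaussw => //; exact: measurableT_comp.
pose J x : \bar R := (\int[pi]_h (wk (n%:R / 2) (x, h) * (gaussw sigma (A x) h)%:E))%E.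
have mJ : measurable_fun setT J.
  apply: (measurable_fun_fubini_tonelli_F (m2 := pi)
    (fun p : n.-tuple X * d.-tuple R => wk (n%:R / 2) p * (gaussw sigma (A p.1) p.2)%:E)%E).
    exact: emeasurable_funM.
  by move=> p; rewrite mule_ge0.
have ME x : M x = ((Z^-1)%:E * J x)%E.
  exact: (integral_gauss pi sigma (Q x) (A x) (hQ x) _ Z Z0 (ZE (A x))
    (measurable_fun_pair2 _ mw) (fun h => w0 _ (x, h))).
have J0 x : (0 <= J x)%E by apply: integral_ge0 => h _; rewrite mule_ge0.
split.
  rewrite (_ : M = fun x => ((Z^-1)%:E * J x)%E); last exact/funext.
  exact: emeasurable_funM.
(* This [t] minimizes [t / 2 * S + G / (2 * t)], with minimum [sqrt (S * G)]. *)
pose t := Num.sqrt (G / S).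
have t0 : 0 < t by rewrite sqrtr_gt0 divr_gt0.
pose e x := expR (enorm (tsub (A x) b) ^+ 2 / sigma ^+ 2).
have e0 x : 0 < e x by exact: expR_gt0.
have me : measurable_fun setT e.
  apply: measurableT_comp; first exact: measurable_expR.
  apply: measurable_funM => //; apply: measurable_funX.
  exact: measurable_enorm_tsub.
pose J1 x : \bar R := (\int[pi]_h (wk n%:R (x, h) * (gaussw sigma b h)%:E))%E.
have mJ1' : measurable_fun setT
   (fun p : n.-tuple X * d.-tuple R => wk n%:R p * (gaussw sigma b p.2)%:E)%E.
  apply: emeasurable_funM => //; apply/measurable_EFinP.
  by apply: measurable_gaussw.
have mJ1 : measurable_fun setT J1.
  apply: (measurable_fun_fubini_tonelli_F (m2 := pi)
    (fun p : n.-tuple X * d.-tuple R => wk n%:R p * (gaussw sigma b p.2)%:E)%E) => //.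
  by move=> p; rewrite mule_ge0.
have J10 x : (0 <= J1 x)%E by apply: integral_ge0 => h _; rewrite mule_ge0.
have JJ1 x : (J x <= (t / 2)%:E * J1 x + (Z / (2 * t))%:E * (e x)%:E)%E.
  (* The centre [c] depends on [x], but its weight integrates to [Z] like any other, so only [e x]
     remains of the second term. *)
  pose c : d.-tuple R := [tuple 2 * tnth (A x) i - tnth b i | i < d].
  have mwx : measurable_fun setT (fun h => wk (n%:R / 2) (x, h)).
    exact: (measurable_fun_pair2 _ mw).
  have mwnx : measurable_fun setT (fun h => wk n%:R (x, h)).
    exact: (measurable_fun_pair2 _ mwn).
  have mq a : measurable_fun setT (fun h => (gaussw sigma a h)%:E).
    by apply/measurable_EFinP; exact: measurable_gaussw1.
  have mwq : measurable_fun setT (fun h => wk n%:R (x, h) * (gaussw sigma b h)%:E)%E.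
    by apply: emeasurable_funM; [exact: mwnx|exact: mq].
  have mwq2 : measurable_fun setT
      (fun h => (t / 2)%:E * (wk n%:R (x, h) * (gaussw sigma b h)%:E))%E.
    by apply: emeasurable_funM; [exact: measurable_cst|exact: mwq].
  have mqc : measurable_fun setT (fun h => (e x / (2 * t))%:E * (gaussw sigma c h)%:E)%E.
    by apply: emeasurable_funM; [exact: measurable_cst|exact: mq].
  apply: (@le_trans _ _ (\int[pi]_h ((t / 2)%:E * (wk n%:R (x, h) * (gaussw sigma b h)%:E)
      + (e x / (2 * t))%:E * (gaussw sigma c h)%:E))%E).
    apply: ge0_le_integral; first exact: measurableT.
    - by move=> h _; apply: mule_ge0; [exact: w0|exact: q0e].
    - by apply: emeasurable_funM; [exact: mwx|exact: mq].
    - by apply: emeasurable_funD; [exact: mwq2|exact: mqc].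
    move=> h _; rewrite -wk_half; apply: amgm_weighted => //.
    by apply: gaussw_sqr => // i; rewrite tnth_mktuple.
  rewrite ge0_integralD; last 5 first.
  - exact: measurableT.
  - by move=> h _; rewrite !mule_ge0// lee_fin divr_ge0// ltW.
  - exact: mwq2.
  - by move=> h _; rewrite mule_ge0// lee_fin divr_ge0 ?ltW// mulr_gt0.
  - exact: mqc.
  rewrite ge0_integralZl; last 4 first.
  - exact: measurableT.
  - exact: mq.
  - by move=> h _; exact: q0e.
  - by rewrite lee_fin divr_ge0 ?ltW// mulr_gt0.
  rewrite ge0_integralZl; last 4 first.
  - exact: measurableT.
  - exact: mwq.
  - by move=> h _; rewrite mule_ge0.
  - by rewrite lee_fin divr_ge0// ltW.
  rewrite ZE -!EFinM leeD2l// lee_fin le_eqVlt; apply/orP; left; apply/eqP; ring.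
(* With the weight centred at the fixed [b], the sample enters only through [wk]: the integrals can
   be exchanged and [kl_mgf] used at each fixed [h]. *)
have IJ1 : (\int[mun]_x J1 x <= (S * Z)%:E)%E.
  rewrite /J1 (fubini_tonelli (fun p : n.-tuple X * d.-tuple R =>
    wk n%:R p * (gaussw sigma b p.2)%:E)%E)//; last first.
    by move=> p; rewrite mule_ge0.
  apply: (@le_trans _ _ (\int[pi]_h (S%:E * (gaussw sigma b h)%:E))%E).
    apply: ge0_le_integral => //.
    - by move=> h _; apply: integral_ge0 => x _; rewrite mule_ge0.
    - apply: (measurable_fun_fubini_tonelli_G (m1 := mun)
        (fun p : n.-tuple X * d.-tuple R => wk n%:R p * (gaussw sigma b p.2)%:E)%E) => //.
      by move=> p; rewrite mule_ge0.
    - apply: emeasurable_funM => //; apply/measurable_EFinP; exact: measurable_gaussw1.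
    move=> h _ /=; rewrite ge0_integralZr//; last first.
      exact: (measurable_fun_pair1 _ mwn).
    rewrite lee_wpmul2r//.
    by apply: (kl_mgf _ _ _ mu _ mun hmun n1 (loss h)) => //; exact: measurable_loss.
  rewrite ge0_integralZl//; last 2 first.
  - by apply/measurable_EFinP; exact: measurable_gaussw1.
  - by rewrite lee_fin ltW.
  by rewrite ZE EFinM.
have -> : (\int[mun]_x M x = (Z^-1)%:E * \int[mun]_x J x)%E.
  rewrite (eq_integral (fun x => (Z^-1)%:E * J x)%E); last by move=> x _; exact: ME.
  apply: ge0_integralZl; [exact: measurableT|exact: mJ|by move=> x _; exact: J0|].
  by rewrite lee_fin.
have t20 : 0 <= t / 2 by rewrite divr_ge0// ltW.
have Zt0 : 0 <= Z / (2 * t) by rewrite divr_ge0 ?ltW// mulr_gt0.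
have me' : measurable_fun setT (fun x => (e x)%:E) by exact/measurable_EFinP.
have e0' x : (0 <= (e x)%:E)%E by rewrite lee_fin ltW.
have mtJ1 : measurable_fun setT (fun x => (t / 2)%:E * J1 x)%E.
  by apply: emeasurable_funM; [exact: measurable_cst|exact: mJ1].
have mZe : measurable_fun setT (fun x => (Z / (2 * t))%:E * (e x)%:E)%E.
  by apply: emeasurable_funM; [exact: measurable_cst|exact: me'].
have IJ : (\int[mun]_x J x <= (t / 2 * (S * Z) + Z / (2 * t) * G)%:E)%E.
  apply: (@le_trans _ _ (\int[mun]_x ((t / 2)%:E * J1 x + (Z / (2 * t))%:E * (e x)%:E))%E).
    apply: ge0_le_integral; [exact: measurableT|by move=> x _; exact: J0|exact: mJ|
      |by move=> x _; exact: JJ1].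
    by apply: emeasurable_funD; [exact: mtJ1|exact: mZe].
  rewrite ge0_integralD; last 5 first.
  - exact: measurableT.
  - by move=> x _; apply: mule_ge0; [rewrite lee_fin|exact: J10].
  - exact: mtJ1.
  - by move=> x _; apply: mule_ge0; [rewrite lee_fin|exact: e0'].
  - exact: mZe.
  have -> : (\int[mun]_x ((t / 2)%:E * J1 x) = (t / 2)%:E * \int[mun]_x J1 x)%E.
    apply: ge0_integralZl; [exact: measurableT|exact: mJ1|by move=> x _; exact: J10|].
    by rewrite lee_fin.
  have -> : (\int[mun]_x ((Z / (2 * t))%:E * (e x)%:E) =
      (Z / (2 * t))%:E * \int[mun]_x (e x)%:E)%E.
    apply: ge0_integralZl; [exact: measurableT|exact: me'|by move=> x _; exact: e0'|].
    by rewrite lee_fin.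
  rewrite EFinD !EFinM.
  apply: leeD; apply: lee_wpmul2l; rewrite -?EFinM ?lee_fin//; exact: hV.
apply: (@le_trans _ _ ((Z^-1)%:E * (t / 2 * (S * Z) + Z / (2 * t) * G)%:E)%E).
  by apply: lee_wpmul2l => //; rewrite lee_fin.
rewrite -EFinM lee_fin le_eqVlt; apply/orP; left; apply/eqP.
have tE : t = Num.sqrt (S * G) / S.
  rewrite /t -[G / S]mul1r -(@mulVf _ S) ?gt_eqF//.
  rewrite (_ : S^-1 * S * (G / S) = S^-1 ^+ 2 * (S * G)); last by field; rewrite gt_eqF.
  by rewrite sqrtrM ?sqr_ge0// sqrtr_sqr ger0_norm ?invr_ge0 ?ltW// mulrC.
have u2 : Num.sqrt (S * G) ^+ 2 = S * G by rewrite sqr_sqrtr// mulr_ge0// ltW.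
have u0 : 0 < Num.sqrt (S * G) by rewrite sqrtr_gt0 mulr_gt0.
rewrite tE; move: (Num.sqrt (S * G)) u2 u0 => u u2 u0.
rewrite (_ : G = u ^+ 2 / S); last by rewrite u2 mulrC mulKf// gt_eqF.
by field; rewrite !gt_eqF.
Qed.
End gibbs.

(* A copy of [pi] on which the sigma-finite structure can be declared. *)
Definition lebesgue_tuple {R : realType} {m : nat}
  (pi : {measure set (m.-tuple R) -> \bar R})
  (hpi : forall B : 'I_m -> set R, (forall i, measurable (B i)) ->
     pi [set h | forall i, B i (tnth h i)] = (\prod_(i < m) lebesgue_measure (B i))%E)
  : set (m.-tuple R) -> \bar R := pi.

Section lebesgue_tuple_instance.
Context {R : realType} {m : nat} (pi : {measure set (m.-tuple R) -> \bar R}).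
Variable hpi : forall B : 'I_m -> set R, (forall i, measurable (B i)) ->
     pi [set h | forall i, B i (tnth h i)] = (\prod_(i < m) lebesgue_measure (B i))%E.

HB.instance Definition _ := isMeasure.Build _ _ _ (lebesgue_tuple pi hpi)
  (measure0 pi) (measure_ge0 pi) (@measure_semi_sigma_additive _ _ _ pi).

HB.instance Definition _ := Measure_isSigmaFinite.Build _ _ _ (lebesgue_tuple pi hpi)
  (lebesgue_tuple_sigma_finite pi hpi).
End lebesgue_tuple_instance.

(** * From the mean bound to a bound with high probability *)

Theorem theorem10 (R : realType) (dX : measure_display) (X : measurableType dX)
  (mu : probability X R) (n d : nat)
  (* mun is the product measure mu^n on X^n *)
  (mun : probability (n.-tuple X) R)
  (hmun : forall B : 'I_n -> set X, (forall i, measurable (B i)) ->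
     mun [set x | forall i, B i (tnth x i)] = (\prod_(i < n) mu (B i))%E)
  (* pi is Lebesgue measure on H = R^d *)
  (pi : {measure set (d.-tuple R) -> \bar R})
  (hpi : forall B : 'I_d -> set R, (forall i, measurable (B i)) ->
     pi [set h | forall i, B i (tnth h i)] = (\prod_(i < d) lebesgue_measure (B i))%E)
  (* each h in R^d is a measurable function X -> [0,1], jointly measurable *)
  (loss : d.-tuple R -> X -> R)
  (hloss_meas : measurable_fun [set: d.-tuple R * X] (fun p => loss p.1 p.2))
  (hloss01 : forall h z, 0 <= loss h z <= 1)
  (A : n.-tuple X -> d.-tuple R) (hA : measurable_fun [set: n.-tuple X] A)
  (sigma : R) (hsigma : 0 < sigma)
  (hcA : ((12 * n)%:R%:E * (sens_coef A * sens_coef A) <= (sigma ^+ 2)%:E)%E)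
  (* Q x = N(A x, sigma^2 I): Gibbs measure w.r.t. pi with Hamiltonian
     - ||h - A x||^2 / (2 sigma^2) *)
  (Q : n.-tuple X -> probability (d.-tuple R) R)
  (hQ : forall x B, measurable B ->
     (Q x B * \int[pi]_h (expR (- enorm (tsub h (A x)) ^+ 2 / (2 * sigma ^+ 2)))%:E
      = \int[pi]_(h in B) (expR (- enorm (tsub h (A x)) ^+ 2 / (2 * sigma ^+ 2)))%:E)%E)
  (hn : (8 < n)%N) (delta : R) (hdelta : 0 < delta) :
  exists E : set (n.-tuple X), measurable E /\ ((1 - delta)%:E <= mun E)%E /\
    forall x, E x -> forall P : probability (d.-tuple R) R,
      (\int[P]_h klb (emp_risk loss h x) (true_risk mu loss h)
       <= (2%:E * KLdiv P (Q x) + (6 / sigma ^+ 2)%:E * var_A mun A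
           + (ln (2 * Num.sqrt n%:R))%:E + (2 * ln (delta^-1))%:E) * (n%:R^-1)%:E)%E.
Proof.
have n1 : (1 < n)%N by exact: leq_trans hn.
have n0 : (0 < n)%N by exact: ltnW.
have n0' : 0 < n%:R :> R by rewrite ltr0n.
pose pi' : {sigma_finite_measure set (d.-tuple R) -> \bar R} := lebesgue_tuple pi hpi.
have s20 : 0 < sigma ^+ 2 by rewrite exprn_gt0.
have [V VE hV] := enorm_sqr_mgf_le _ _ _ _ _ _ _ hmun A hA _ n0 s20 hcA (mean_vec mun A).
pose S : R := 2 * Num.sqrt n%:R.
pose G : R := expR (6 / sigma ^+ 2 * V).
pose C := Num.sqrt (S * G).
have S0 : 0 < S by rewrite mulr_gt0// sqrtr_gt0.
have C0 : 0 < C by rewrite sqrtr_gt0 mulr_gt0// expR_gt0.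
pose F (x : n.-tuple X) h := ((n%:R / 2)%:E * klb (emp_risk loss h x) (true_risk mu loss h))%E.
pose M x := (\int[Q x]_h expeR (F x h))%E.
have [mM IM] : measurable_fun setT M /\ (\int[mun]_x M x <= C%:E)%E.
  exact: (gibbs_mgf_meas_le mu mun hmun pi' hpi loss hloss_meas hloss01 A hA
    sigma hsigma Q hQ n1 V (mean_vec mun A) hV).
have M0 x : (0 <= M x)%E by apply: integral_ge0 => h _; exact: expeR_ge0.
(* Markov's inequality at level [C / delta] bounds the measure of the complement by [delta]. [E] is
   fixed before [P] appears, which makes the conclusion uniform in [P]. *)
pose E := [set x | (M x < (C / delta)%:E)%E].
have mE : measurable E.
  by rewrite -[E]setTI; exact: emeasurable_fun_infty_o.
exists E; split => //; split.
  have Cd0 : 0 < C / delta by rewrite divr_gt0.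
  have := le_integral_abse mun measurableT mM Cd0.
  rewrite setTI (eq_integral M); last by move=> x _; rewrite gee0_abs.
  move=> /le_trans/(_ IM).
  have -> : [set x | ((C / delta)%:E <= `|M x|)%E] = ~` E.
    apply/seteqP; split=> x /=; rewrite /E/= gee0_abs//.
      by move=> h /(le_lt_trans h); rewrite ltxx.
    by move=> /negP; rewrite -leNgt.
  have EC : mun (~` E) = (1 - mun E)%E := probability_setC mun mE.
  have Efin : mun E \is a fin_num by exact: fin_num_measure.
  move=> h; have {}h : ((C / delta)%:E * mun (~` E) <= C%:E)%E := h.
  move: h; rewrite EC -(fineK Efin) -EFinB -EFinM !lee_fin mulrAC ler_pdivrMr//.
  by rewrite ler_pM2l// => ?; lra.
move=> x Ex P.
have F0 h : (0 <= klb (emp_risk loss h x) (true_risk mu loss h))%E.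
  exact: (kl_ge0 mu loss hloss_meas hloss01 n1).
have mK : measurable_fun setT (fun h => klb (emp_risk loss h x) (true_risk mu loss h)).
  exact: (measurable_fun_pair2 _ (measurable_kl_pair mu loss hloss_meas hloss01 n1)).
have mF : measurable_fun setT (F x) by exact: emeasurable_funM.
have n20 : (0 <= (n%:R / 2 : R)%:E)%E by rewrite lee_fin divr_ge0.
have := donsker_varadhan _ _ _ P (Q x) (F x) (C / delta) mF.
move=> /(_ (fun h => mule_ge0 n20 (F0 h)) (ltW Ex)).
rewrite ge0_integralZl//.
have -> : var_A mun A = V%:E by exact: VE.
(* Doubling undoes the square root in [C = sqrt (S * G)], and [ln G] is the variance term. *)
have KE : 2 * ln (C / delta) = 6 / sigma ^+ 2 * V + ln S + 2 * ln (delta^-1).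
  rewrite lnM ?posrE ?invr_gt0// mulrDr; congr (_ + _).
  rewrite mulr_natl -lnXn// sqr_sqrtr; last by rewrite mulr_ge0 ?expR_ge0// ltW.
  by rewrite lnM ?posrE ?expR_gt0// expRK addrC.
have : (0 <= \int[P]_h klb (emp_risk loss h x) (true_risk mu loss h))%E by exact: integral_ge0.
case: (\int[P]_h klb (emp_risk loss h x) (true_risk mu loss h))%E => [I _|_|//];
  case: (KLdiv P (Q x)) => [K||] //.
- rewrite -!EFinM -!EFinD !lee_fin => h.
  rewrite ler_pdivlMr//; move: KE h; rewrite -/S; lra.
- move=> _; rewrite gt0_muley ?lte_fin// -EFinM !addye//.
  by rewrite gt0_mulye ?lte_fin ?invr_gt0// leey.
- by rewrite gt0_muley ?lte_fin ?divr_gt0.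
- move=> _; rewrite gt0_muley ?lte_fin// -EFinM !addye//.
  by rewrite gt0_mulye ?lte_fin ?invr_gt0.
- by rewrite gt0_muley ?lte_fin ?divr_gt0.
Qed.
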